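(* Let $(M,\omega_t,\mathcal P_t)$ be a formal polarized symplectic manifold and let $\nabla$ be a $\mathcal P_t$-symplectic connection. Let $\nabla^2|_{\mathcal P_t}$ denote the curvature of $\nabla$ restricted to $\mathcal P_t$. Then $\mathrm{tr}(\nabla^2|_{\mathcal P_t})$ belongs to $\Gamma(M,d\mathcal P_t^\perp)$. If $\nabla_1$ is another $\mathcal P_t$-symplectic connection, then $\mathrm{tr}(\nabla_1^2|_{\mathcal P_t})$ differs from $\mathrm{tr}(\nabla^2|_{\mathcal P_t})$ by an element of $d(\Gamma(M,\mathcal P_t^\perp))$.
   Context: $M$ is a smooth manifold, $C_M^\infty$ the sheaf of complex-valued smooth functions, $\mathcal T$ its complexified tangent bundle, $\mathcal T^*$ the complex dual, $t$ a formal parameter. A formal polarized symplectic manifold $(M,\omega_t,\mathcal P_t)$: $\omega_t=\omega_0+t\omega_1+\cdots$ is a formal closed complex 2-form with $\omega_0$ nondegenerate, $\mathcal P_t\subset\mathcal T[[t]]$ is a formal subbundle (a $t$-adically complete subsheaf of $C_M^\infty[[t]]$-modules such that $tb\in\mathcal P_t$, $b\in\mathcal T[[t]]$ imply $b\in\mathcal P_t$), and locally there are formal coordinates $x_i,y_i\in C_M^\infty[[t]]$, $i=1,\dots,\frac12\dim M$, with $\omega_t=\sum dy_i\wedge dx_i$ and $\mathcal P_t$ equal to the common kernel of the $dx_i$. $\mathcal P_t^\perp\subset\mathcal T^*[[t]]$ is the annihilator of $\mathcal P_t$, and $d\mathcal P_t^\perp$ is the image sheaf of $\mathcal P_t^\perp$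 under the de Rham differential. A $\mathcal P_t$-symplectic connection is a connection $\nabla$ on $\mathcal T[[t]]$ which preserves $\omega_t$ and is torsion free, preserves $\mathcal P_t$ ($\nabla_X\mathcal P_t\subset\mathcal P_t$ for all $X$), and is flat on $\mathcal P_t$ along $\mathcal P_t$: $(\nabla_X\nabla_Y-\nabla_Y\nabla_X-\nabla_{[X,Y]})(\mathcal P_t)=0$ for $X,Y\in\mathcal P_t$. *)

(* Defs.v *)
From HB Require Import structures.
From mathcomp Require Import all_boot all_order all_algebra.
From mathcomp Require Import complex.
From mathcomp Require Import all_classical all_reals all_analysis.
Set Implicit Arguments.
Unset Strict Implicit.
Unset Printing Implicit Defensive.
Import Order.TTheory GRing.Theory Num.Theory numFieldNormedType.Exports.
Local Open Scope classical_set_scope.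
Local Open Scope ring_scope.

Definition opensub {T : topologicalType} (U V : set T) : Prop :=
  open V /\ V `<=` U.

Definition opennbhs_in {T : topologicalType} (U : set T) (p : T) (V : set T) :
  Prop := opensub U V /\ V p.

Section SmoothManifolds.
Variable R : realType.

Definition iter_derive {m} {W : normedModType R} (f : 'rV[R]_m -> W)
  (vs : seq 'rV[R]_m) : 'rV[R]_m -> W :=
  foldr (fun v g => fun x => 'D_v g x) f vs.

(* C^oo on the open set O: 'D_v is total, so existence of every iterated
   directional derivative has to be required explicitly. *)
Definition smooth_on {m} {W : normedModType R} (O : set 'rV[R]_m)
  (f : 'rV[R]_m -> W) : Prop :=
  forall (vs : seq 'rV[R]_m) (x : 'rV[R]_m), O x ->
    {for x, continuous (iter_derive f vs)} /\
    forall v, derivable (iter_derive f vs) x v.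

Record chart (T : topologicalType) (m : nat) := Chart {
  chart_dom : set T;
  chart_map : T -> 'rV[R]_m;
  chart_inv : 'rV[R]_m -> T }.

Definition is_chart (T : topologicalType) m (c : chart T m) : Prop :=
  [/\ open (chart_dom c),
      open (chart_map c @` chart_dom c),
      {within chart_dom c, continuous (chart_map c)},
      {within chart_map c @` chart_dom c, continuous (chart_inv c)} &
      forall p, chart_dom c p -> chart_inv c (chart_map c p) = p].

Record smoothManifold (m : nat) := SmoothManifold {
  manifold_space :> topologicalType;
  atlas : set (chart manifold_space m);
  manifold_hausdorff : hausdorff_space manifold_space;
  manifold_second_countable : @second_countable manifold_space;
  atlas_chart : forall c, atlas c -> is_chart c;
  atlas_cover : forall p, exists2 c, atlas c & chart_dom c p;
  atlas_transition : forall c c', atlas c -> atlas c' ->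
    smooth_on (chart_map c @` (chart_dom c `&` chart_dom c'))
      (fun x => chart_map c' (chart_inv c x)) }.

End SmoothManifolds.

(* Sections over an open U of the sheaves below are represented by total
   functions or operators that satisfy the corresponding predicate "on U"; two
   of them denote the same section when they agree in the sense of the matching
   [eq_..] relation, and restriction to a smaller open set is the identity on
   representatives.  Vector fields are sections of the complexified tangent
   bundle, i.e. C-linear derivations of the sheaf of complex-valued smooth
   functions; forms are C^oo-multilinear maps on them, and elements of A[[t]]
   are coefficient sequences. *)
Notation functionT R M := (M -> R[i]).
Notation vfieldT R M := (functionT R M -> functionT R M).
Notation form1T R M := (vfieldT R M -> functionT R M).
Notation form2T R M := (vfieldT R M -> vfieldT R M -> functionT R M).
Notation formal A := (nat -> A).

Section FormalSeries.

Definition coefwise {A} (Q : A -> Prop) (a : formal A) : Prop :=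
  forall k, Q (a k).
Definition coefwise2 {A} (E : A -> A -> Prop) (a b : formal A) : Prop :=
  forall k, E (a k) (b k).

Definition cauchy {A B} {V : nmodType} (op : A -> B -> V)
  (a : formal A) (b : formal B) : formal V :=
  fun k => \sum_(i < k.+1) op (a i) (b (k - i)%N).

Definition fapp {A} {V : nmodType} : formal (A -> V) -> formal A -> formal V :=
  cauchy (fun f a => f a).

Definition tconst {V : nmodType} (a : V) : formal V :=
  fun k => if k is 0 then a else 0.

Definition tmul {V : nmodType} (a : formal V) : formal V :=
  fun k => if k is k'.+1 then a k' else 0.

End FormalSeries.

Section Calculus.
Variables (R : realType) (m : nat) (M : smoothManifold R m).
Implicit Types (U V W : set M) (f g : functionT R M) (X Y Z : vfieldT R M).

Definition smooth U f : Prop :=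
  forall c, atlas c ->
    smooth_on (chart_map c @` (chart_dom c `&` U))
      (fun x => complex.Re (f (chart_inv c x))) /\
    smooth_on (chart_map c @` (chart_dom c `&` U))
      (fun x => complex.Im (f (chart_inv c x))).

Definition eq_fun U f g : Prop := forall p, U p -> f p = g p.

Definition scale {T : Type} f (A : T -> functionT R M) : T -> functionT R M :=
  fun z => f * A z.

Definition is_vfield U X : Prop :=
  forall V, opensub U V ->
  [/\ forall f, smooth V f -> smooth V (X f),
      forall f g, smooth V f -> eq_fun V f g -> eq_fun V (X f) (X g),
      forall (a : R[i]) f g, smooth V f -> smooth V g ->
        eq_fun V (X (cst a * f + g)) (cst a * X f + X g) &
      forall f g, smooth V f -> smooth V g ->
        eq_fun V (X (f * g)) (X f * g + f * X g)].

Definition eq_vfield U X Y : Prop :=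
  forall V f, opensub U V -> smooth V f -> eq_fun V (X f) (Y f).

Definition bracket X Y : vfieldT R M := fun f => X (Y f) - Y (X f).

Definition is_form1 U (alpha : form1T R M) : Prop :=
  forall V, opensub U V ->
  [/\ forall X, is_vfield V X -> smooth V (alpha X),
      forall X Y, is_vfield V X -> eq_vfield V X Y ->
        eq_fun V (alpha X) (alpha Y) &
      forall f X Y, smooth V f -> is_vfield V X -> is_vfield V Y ->
        eq_fun V (alpha (scale f X + Y)) (f * alpha X + alpha Y)].

Definition eq_form1 U (alpha beta : form1T R M) : Prop :=
  forall V X, opensub U V -> is_vfield V X -> eq_fun V (alpha X) (beta X).

Definition is_form2 U (omega : form2T R M) : Prop :=
  forall V X, opensub U V -> is_vfield V X ->
  [/\ is_form1 V (omega X),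
      is_form1 V (fun Y => omega Y X) &
      eq_fun V (omega X X) 0].

Definition eq_form2 U (omega eta : form2T R M) : Prop :=
  forall V X Y, opensub U V -> is_vfield V X -> is_vfield V Y ->
    eq_fun V (omega X Y) (eta X Y).

Definition d0 f : form1T R M := fun X => X f.

Definition d1 (alpha : form1T R M) : form2T R M :=
  fun X Y => X (alpha Y) - Y (alpha X) - alpha (bracket X Y).

Definition closed2 U (omega : form2T R M) : Prop :=
  forall V X Y Z, opensub U V ->
    is_vfield V X -> is_vfield V Y -> is_vfield V Z ->
    eq_fun V (X (omega Y Z) - Y (omega X Z) + Z (omega X Y)
              - omega (bracket X Y) Z + omega (bracket X Z) Y
              - omega (bracket Y Z) X) 0.

Definition wedge (alpha beta : form1T R M) : form2T R M :=
  fun X Y => alpha X * beta Y - alpha Y * beta X.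

(* The map X |-> omega(X, -) from vector fields to 1-forms is an isomorphism of
   sheaves. *)
Definition nondegenerate (omega : form2T R M) : Prop :=
  forall U alpha, open U -> is_form1 U alpha ->
  exists X, [/\ is_vfield U X, eq_form1 U (omega X) alpha &
    forall Y, is_vfield U Y -> eq_form1 U (omega Y) alpha -> eq_vfield U X Y].

End Calculus.

Section FormalCalculus.
Variables (R : realType) (m : nat) (M : smoothManifold R m).
Implicit Types (U V W : set M) (f g : formal (functionT R M)).
Implicit Types (X Y Z : formal (vfieldT R M)).

Definition fsmooth U := coefwise (@smooth R m M U).
Definition feq_fun U := coefwise2 (@eq_fun R m M U).
Definition fvfield U := coefwise (@is_vfield R m M U).
Definition feq_vfield U := coefwise2 (@eq_vfield R m M U).
Definition fform1 U := coefwise (@is_form1 R m M U).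
Definition feq_form1 U := coefwise2 (@eq_form1 R m M U).
Definition fform2 U := coefwise (@is_form2 R m M U).
Definition feq_form2 U := coefwise2 (@eq_form2 R m M U).

Definition fmul : formal (functionT R M) -> formal (functionT R M) ->
  formal (functionT R M) := cauchy (fun f0 g0 : functionT R M => f0 * g0).
Definition fscale {T : Type} : formal (functionT R M) ->
  formal (T -> functionT R M) -> formal (T -> functionT R M) :=
  cauchy (@scale R m M T).
Definition fbracket : formal (vfieldT R M) -> formal (vfieldT R M) ->
  formal (vfieldT R M) := cauchy (@bracket R m M).
Definition fwedge : formal (form1T R M) -> formal (form1T R M) ->
  formal (form2T R M) := cauchy (@wedge R m M).
Definition fd0 f : formal (form1T R M) := fun k => d0 (f k).
Definition fd1 (alpha : formal (form1T R M)) : formal (form2T R M) :=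
  fun k => d1 (alpha k).
Definition fpair2 (omega : formal (form2T R M)) X Y : formal (functionT R M) :=
  fapp (fapp omega X) Y.

(* [e] is a basis over U of the sheaf of C^oo[[t]]-modules with sections [S] and
   equality of sections [E]. *)
Definition is_basis {T : Type}
  (S : set M -> formal (T -> functionT R M) -> Prop)
  (E : set M -> formal (T -> functionT R M) -> formal (T -> functionT R M)
       -> Prop)
  U (J : finType) (e : J -> formal (T -> functionT R M)) : Prop :=
  (forall j, S U (e j)) /\
  forall V s, opensub U V -> S V s ->
  exists c : J -> formal (functionT R M),
  [/\ forall j, fsmooth V (c j),
      E V s (\sum_j fscale (c j) (e j)) &
      forall c', (forall j, fsmooth V (c' j)) ->
        E V s (\sum_j fscale (c' j) (e j)) ->
        forall j, feq_fun V (c j) (c' j)].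

Definition formal_coordinates U n (x y : 'I_n -> formal (functionT R M)) :
  Prop :=
  [/\ forall i, fsmooth U (x i),
      forall i, fsmooth U (y i) &
      is_basis fform1 feq_form1 U
        (fun j : 'I_n + 'I_n =>
           match j with inl i => fd0 (x i) | inr i => fd0 (y i) end)].

Section Polarization.
Variable P : set M -> set (formal (vfieldT R M)).

Record is_subsheaf : Prop := IsSubsheaf {
  subsheaf_vfield : forall U X, open U -> P U X -> fvfield U X;
  subsheaf_eq : forall U X Y, open U -> P U X -> feq_vfield U X Y -> P U Y;
  subsheaf_restrict : forall U V X, open U -> opensub U V -> P U X -> P V X;
  subsheaf_glue : forall U X, open U -> fvfield U X ->
    (forall p, U p -> exists2 V, opennbhs_in U p V & P V X) -> P U X }.

Definition is_submodule : Prop :=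
  forall U, open U ->
  P U 0 /\
  forall f X Y, fsmooth U f -> P U X -> P U Y -> P U (fscale f X + Y).

Definition cong_tadic U (j : nat) X Y : Prop :=
  exists2 Z, P U Z & feq_vfield U (X - Y) (iter j tmul Z).

(* Separatedness is automatic inside the sheaf of formal vector fields. *)
Definition tadically_complete : Prop :=
  forall U (Xs : nat -> formal (vfieldT R M)), open U ->
  (forall j, P U (Xs j)) -> (forall j, cong_tadic U j (Xs j.+1) (Xs j)) ->
  exists2 X, P U X & forall j, cong_tadic U j X (Xs j).

Definition tsaturated : Prop :=
  forall U X, open U -> fvfield U X -> P U (tmul X) -> P U X.

Definition formal_subbundle : Prop :=
  [/\ is_subsheaf, is_submodule, tadically_complete & tsaturated].

Definition perp U (alpha : formal (form1T R M)) : Prop :=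
  fform1 U alpha /\
  forall V X, opensub U V -> P V X -> feq_fun V (fapp alpha X) 0.

Definition dperp U (tau : formal (form2T R M)) : Prop :=
  fform2 U tau /\
  forall p, U p -> exists2 V, opennbhs_in U p V &
    exists2 alpha, perp V alpha & feq_form2 V tau (fd1 alpha).

(* Trace of an endomorphism of the locally free sheaf P; the value of each
   coefficient at p is computed in a basis of P near p. *)
Definition trace_on (phi : formal (vfieldT R M) -> formal (vfieldT R M)) :
  formal (functionT R M) :=
  fun k p => xget 0 [set z |
    exists (W : set M) (r : nat) (e : 'I_r -> formal (vfieldT R M))
           (a : 'I_r -> 'I_r -> formal (functionT R M)),
    [/\ open W /\ W p,
        is_basis P feq_vfield W e,
        forall i j, fsmooth W (a i j),
        forall j, feq_vfield W (phi (e j)) (\sum_i fscale (a i j) (e i)) &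
        z = \sum_i a i i k p]].

End Polarization.

Definition darboux (omega : formal (form2T R M))
  (P : set M -> set (formal (vfieldT R M))) : Prop :=
  forall p : M, exists U (x y : 'I_(m./2) -> formal (functionT R M)),
  [/\ open U /\ U p,
      formal_coordinates U x y,
      feq_form2 U omega (\sum_i fwedge (fd0 (y i)) (fd0 (x i))) &
      forall V X, opensub U V -> fvfield V X ->
        (P V X <-> forall i, feq_fun V (fapp (fd0 (x i)) X) 0)].

Record formal_polarized_symplectic (omega : formal (form2T R M))
  (P : set M -> set (formal (vfieldT R M))) : Prop :=
  FormalPolarizedSymplectic {
  fps_form : fform2 setT omega;
  fps_closed : coefwise (@closed2 R m M setT) omega;
  fps_nondegenerate : nondegenerate (omega 0%N);
  fps_subbundle : formal_subbundle P;
  fps_darboux : darboux omega P }.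

Implicit Type nabla : formal (vfieldT R M) -> formal (vfieldT R M) ->
  formal (vfieldT R M).

(* [nabla X Y] is the covariant derivative of Y along X. *)
Record is_connection nabla : Prop := IsConnection {
  conn_vfield : forall U X Y, open U -> fvfield U X -> fvfield U Y ->
    fvfield U (nabla X Y);
  conn_eq : forall U X X' Y Y', open U -> fvfield U X -> fvfield U Y ->
    feq_vfield U X X' -> feq_vfield U Y Y' ->
    feq_vfield U (nabla X Y) (nabla X' Y');
  conn_linear : forall U f X X' Y, open U -> fsmooth U f ->
    fvfield U X -> fvfield U X' -> fvfield U Y ->
    feq_vfield U (nabla (fscale f X + X') Y)
      (fscale f (nabla X Y) + nabla X' Y);
  conn_add : forall U X Y Y', open U ->
    fvfield U X -> fvfield U Y -> fvfield U Y' ->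
    feq_vfield U (nabla X (Y + Y')) (nabla X Y + nabla X Y');
  conn_leibniz : forall U f X Y, open U -> fsmooth U f ->
    fvfield U X -> fvfield U Y ->
    feq_vfield U (nabla X (fscale f Y))
      (fscale (fapp X f) Y + fscale f (nabla X Y)) }.

Definition curvature nabla X Y Z : formal (vfieldT R M) :=
  nabla X (nabla Y Z) - nabla Y (nabla X Z) - nabla (fbracket X Y) Z.

Record symplectic_connection (omega : formal (form2T R M))
  (P : set M -> set (formal (vfieldT R M))) nabla : Prop :=
  SymplecticConnection {
  sc_connection : is_connection nabla;
  sc_preserves_form : forall U X Y Z, open U ->
    fvfield U X -> fvfield U Y -> fvfield U Z ->
    feq_fun U (fapp X (fpair2 omega Y Z))
      (fpair2 omega (nabla X Y) Z + fpair2 omega Y (nabla X Z));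
  sc_torsion_free : forall U X Y, open U -> fvfield U X -> fvfield U Y ->
    feq_vfield U (nabla X Y - nabla Y X) (fbracket X Y);
  sc_preserves_polarization : forall U X Y, open U -> fvfield U X ->
    P U Y -> P U (nabla X Y);
  sc_flat : forall U X Y Z, open U -> P U X -> P U Y -> P U Z ->
    feq_vfield U (curvature nabla X Y Z) 0 }.

(* The formal 2-form (v, w) |-> tr (curvature nabla v w restricted to P), given
   by its coefficients, hence evaluated on vector fields constant in t. *)
Definition trace_curvature (P : set M -> set (formal (vfieldT R M))) nabla :
  formal (form2T R M) :=
  fun k v w => trace_on P (curvature nabla (tconst v) (tconst w)) k.

End FormalCalculus.

(* Main.v *)
(** In Darboux coordinates [x_i, y_i] let [e_i] be the Hamiltonian vector field
    of [x_i], that is [omega(e_i, -) = dx_i].  The [e_i] form a basis of [P] whose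
    coordinate functionals on [P] are the [dy_i].  If [X] belongs to [P], then
    [nabla_X e_i = 0]: this only uses that [nabla] is torsion free and preserves
    [omega] and [P], so that no differential equation has to be solved to obtain
    a frame of [P] that is flat along [P].  Hence the connection matrix [theta]
    of [nabla] in the frame [e_i] has entries in [P^perp], and the trace of
    the curvature [d theta + theta wedge theta] is [d (tr theta)].  For two
    connections, [tr theta_1 - tr theta] is the trace of the tensor
    [nabla_1 - nabla] restricted to [P]; it does not depend on the coordinates, so
    that these local forms glue to a section of [P^perp]. *)
Require Import Defs.
From HB Require Import structures.
From mathcomp Require Import all_boot all_order all_algebra.
From mathcomp Require Import complex ring.
From mathcomp Require Import all_classical all_reals all_analysis.
Import GRing.Theory numFieldNormedType.Exports.
Local Open Scope classical_set_scope.
Local Open Scope ring_scope.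
(* [eq_fun] is shadowed by the library constant of the same name. *)
Import Defs.
Set Implicit Arguments.
Unset Strict Implicit.
Unset Printing Implicit Defensive.

(** * Smooth functions *)

(** One obstacle is representation. Sections are total functions and operators that are meaningful
    on an open set only, and [trace_on] chooses its value among those given by all local bases. Its
    independence of the basis has to come before any computation with a trace, and the traces are
    recognized as differential forms by comparison with local formulas. Pointwise identities are
    moved by [ev] into the commutative ring of power series over [R[i]], where Cauchy products are
    ordinary products. Another obstacle is that the coefficients of a form are tested on fields
    constant in t, whereas a section of [P] is a series whose coefficients need not lie in [P].
    Membership in P^perp is therefore checked on maps of formal fields that are linear over formal
    series, and transferred to forms by [form_of]. The frame is built from [omega] and [P] alone,
    order by order in t with only [omega 0] inverted, so that the same frame serves both
    connections. *)

Section SmoothOn.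
Variables (R : realType) (m : nat).
Implicit Types (O : set 'rV[R]_m) (f g : 'rV[R]_m -> R).

(* Differentiability classes of finite order, so that the stability of
   smoothness can be proved by induction on the order. *)
Fixpoint Cn_on n O f : Prop :=
  (forall x, O x -> {for x, continuous f} /\ forall v, derivable f x v) /\
  (if n is n'.+1 then forall v, Cn_on n' O ('D_v f) else True).

Lemma smooth_onP O f : smooth_on O f <-> forall n, Cn_on n O f.
Proof.
split=> [fO n | fO vs x Ox].
  elim: n => [|n IHn] in f fO *; (split=> [x Ox|];
    first exact: (fO [::])) => //.
  move=> v; apply: IHn => vs x Ox; have := fO (rcons vs v) x Ox.
  by rewrite /iter_derive foldr_rcons.
have {fO}: Cn_on (size vs) O f by [].
elim/last_ind: vs => [|vs v IHvs] in f *; first by case=> fO _; exact: fO.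
rewrite size_rcons /iter_derive foldr_rcons => -[_ /(_ v)]; exact: IHvs.
Qed.

Lemma near_eq_for_continuous f g x : (\forall y \near x, f y = g y) ->
  {for x, continuous f} -> {for x, continuous g}.
Proof.
move=> fg cf; have fgx : f x = g x by exact: nbhs_singleton fg.
rewrite /prop_for /continuous_at -fgx.
apply: cvg_trans cf; exact: (@near_eq_cvg _ _ (nbhs x) (nbhs_filter x)).
Qed.

Lemma Cn_on_eq n O f g : open O -> (forall x, O x -> f x = g x) ->
  Cn_on n O f -> Cn_on n O g.
Proof.
move=> oO;
have near_fg f' g' : (forall x, O x -> f' x = g' x) ->
    forall x, O x -> \forall y \near x, f' y = g' y.
  by move=> fg x Ox; apply: filterS fg _; exact: open_nbhs_nbhs.
elim: n => [|n IHn] in f g *; move=> fg [f0 f1].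
all: have g0 x : O x -> {for x, continuous g} /\ forall v, derivable g x v.
1,3: move=> Ox; have [cf df] := f0 x Ox; have nfg := near_fg _ _ fg x Ox.
1,2: by split=> [|v]; [exact: near_eq_for_continuous nfg cf
                      |exact: near_eq_derivable nfg (df v)].
all: split=> // v.
by apply: IHn (f1 v) => x Ox; exact: near_eq_derive (near_fg _ _ fg x Ox).
Qed.

(** Needed for products: the Leibniz rule multiplies a derivative, which has lost one order, by an
    undifferentiated factor. *)
Lemma Cn_onS n O f : Cn_on n.+1 O f -> Cn_on n O f.
Proof.
elim: n => [|n IHn] in f *; first by case.
by case=> f0 f1; split=> // v; exact: IHn.
Qed.

Lemma Cn_onD n O f g : open O -> Cn_on n O f -> Cn_on n O g ->
  Cn_on n O (f + g).
Proof.
move=> oO; elim: n => [|n IHn] in f g *; move=> [f0 f1] [g0 g1].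
all: split; [move=> x Ox; have [cf df] := f0 x Ox; have [cg dg] := g0 x Ox;
  by split=> [|v]; [exact: continuousD | exact: derivableD] | move=> // v].
apply: (@Cn_on_eq _ _ ('D_v f + 'D_v g)) (IHn _ _ (f1 v) (g1 v)) => // x Ox.
by rewrite deriveD //; [case: (f0 x Ox) | case: (g0 x Ox)].
Qed.

Lemma Cn_onM n O f g : open O -> Cn_on n O f -> Cn_on n O g ->
  Cn_on n O (f * g).
Proof.
move=> oO; elim: n => [|n IHn] in f g *; move=> hf hg.
all: have [f0 f1] := hf; have [g0 g1] := hg.
all: split; [move=> x Ox; have [cf df] := f0 x Ox; have [cg dg] := g0 x Ox;
  by split=> [|v]; [exact: continuousM | apply: derivableM;
    [exact: df|exact: dg]] | move=> // v].
apply: (@Cn_on_eq _ _ (f * 'D_v g + g * 'D_v f)) => //.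
  by move=> x Ox; rewrite deriveM //; [case: (f0 x Ox) | case: (g0 x Ox)].
by apply: Cn_onD => //; apply: IHn;
  [exact: Cn_onS hf|exact: g1|exact: Cn_onS hg|exact: f1].
Qed.

Lemma Cn_on_cst n O (a : R) : Cn_on n O (cst a).
Proof.
have c0 x : {for x, continuous (@cst 'rV[R]_m R a)} /\
    forall v, derivable (@cst 'rV[R]_m R a) x v.
  by split=> [|v]; [exact: cst_continuous | exact: derivable_cst].
elim: n a c0 => [|n IHn] a c0; split=> // v.
have -> : 'D_v (@cst 'rV[R]_m R a) = cst 0 by apply/funext => x;
  rewrite derive_cst.
apply: IHn => x.
by split=> [|w]; [exact: cst_continuous | exact: derivable_cst].
Qed.

Lemma smooth_on_eq O f g : open O -> (forall x, O x -> f x = g x) ->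
  smooth_on O f -> smooth_on O g.
Proof.
by move=> oO fg /smooth_onP h; apply/smooth_onP => n; exact: Cn_on_eq (h n).
Qed.

Lemma smooth_onD O f g : open O -> smooth_on O f -> smooth_on O g ->
  smooth_on O (f + g).
Proof.
by move=> oO /smooth_onP hf /smooth_onP hg; apply/smooth_onP => n;
  exact: Cn_onD.
Qed.

Lemma smooth_onM O f g : open O -> smooth_on O f -> smooth_on O g ->
  smooth_on O (f * g).
Proof.
by move=> oO /smooth_onP hf /smooth_onP hg; apply/smooth_onP => n;
  exact: Cn_onM.
Qed.

Lemma smooth_on_cst O (a : R) : smooth_on O (cst a).
Proof. by apply/smooth_onP => n; exact: Cn_on_cst. Qed.

End SmoothOn.

(** * Complex-valued smooth functions on the manifold *)

Section Smooth.
Variables (R : realType) (m : nat) (M : smoothManifold R m).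
Implicit Types (U V : set M) (f g : functionT R M).

Let Re_add (z w : R[i]) : complex.Re (z + w) = complex.Re z + complex.Re w.
Proof. by case: z w => a b []. Qed.

Let Im_add (z w : R[i]) : complex.Im (z + w) = complex.Im z + complex.Im w.
Proof. by case: z w => a b []. Qed.

(** The minus sign is a product with the constant [-1], to match the closure of [smooth_on] under
    sums, products and constants. *)
Let Re_mul (z w : R[i]) : complex.Re (z * w) =
  complex.Re z * complex.Re w + -1 * (complex.Im z * complex.Im w).
Proof. by case: z w => a b [c d]; rewrite mulN1r. Qed.

Let Im_mul (z w : R[i]) : complex.Im (z * w) =
  complex.Re z * complex.Im w + complex.Im z * complex.Re w.
Proof. by case: z w => a b [c d]. Qed.

(** The image is the part of the open chart image that the inverse chart, continuous there, sends
    into [U]. *)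
Lemma open_chart_image c U : atlas c -> open U ->
  open (chart_map c @` (chart_dom c `&` U)).
Proof.
move=> /atlas_chart[_ oc _ ci cK] oU.
have -> : chart_map c @` (chart_dom c `&` U) =
    (chart_map c @` chart_dom c) `&` chart_inv c @^-1` U.
  apply/seteqP; split=> [_ [p [cp Up] <-]|_ [[p cp <-]]] /=.
    by rewrite cK //; split=> //; exists p.
  by rewrite cK // => Up; exists p.
by move: ci; rewrite continuous_open_subspace // => /(continuous_inP _ oc);
  exact.
Qed.

Lemma smooth_eq U f g : open U -> eq_fun U f g -> smooth U f -> smooth U g.
Proof.
move=> oU fg hf c ac; have oO := open_chart_image ac oU.
have [_ _ _ _ cK] := atlas_chart ac; have [hr hi] := hf c ac.
by split; [apply: smooth_on_eq hr | apply: smooth_on_eq hi] => // _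
  [p [cp Up] <-]; rewrite cK // fg.
Qed.

Lemma smoothD U f g : open U -> smooth U f -> smooth U g -> smooth U (f + g).
Proof.
move=> oU hf hg c ac; have oO := open_chart_image ac oU.
have [hfr hfi] := hf c ac; have [hgr hgi] := hg c ac.
split; [apply: smooth_on_eq (smooth_onD _ hfr hgr)
       |apply: smooth_on_eq (smooth_onD _ hfi hgi)] => // x _.
exact/esym/Re_add.
exact/esym/Im_add.
Qed.

Lemma smoothM U f g : open U -> smooth U f -> smooth U g -> smooth U (f * g).
Proof.
move=> oU hf hg c ac; have oO := open_chart_image ac oU.
have [hfr hfi] := hf c ac; have [hgr hgi] := hg c ac.
have hN := @smooth_on_cst R m (chart_map c @` (chart_dom c `&` U)) (-1 : R).
split.
  apply: smooth_on_eq (smooth_onD _ (smooth_onM _ hfr hgr)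
    (smooth_onM _ hN (smooth_onM _ hfi hgi))) => // x _.
  exact/esym/Re_mul.
apply: smooth_on_eq (smooth_onD _ (smooth_onM _ hfr hgi)
    (smooth_onM _ hfi hgr)) => // x _.
exact/esym/Im_mul.
Qed.

Lemma smooth_cst U (a : R[i]) : smooth U (cst a : functionT R M).
Proof. by move=> c _; split; exact: smooth_on_cst. Qed.

Lemma smooth_sub U V f : V `<=` U -> smooth U f -> smooth V f.
Proof.
move=> VU hf c ac; have [hr hi] := hf c ac.
have sub : chart_map c @` (chart_dom c `&` V) `<=`
    chart_map c @` (chart_dom c `&` U).
  by move=> _ [p [cp /VU Up] <-]; exists p.
by split=> vs x /sub; [exact: hr | exact: hi].
Qed.

Lemma smooth_local U f :
  (forall p, U p -> exists2 V : set M, V p & smooth V f) -> smooth U f.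
Proof.
move=> hf c ac; split=> vs _ [p [cp Up] <-].
all: have [V Vp /(_ c ac)[hr hi]] := hf p Up.
  by apply: hr; exists p.
by apply: hi; exists p.
Qed.

Lemma smooth0 U : smooth U (0 : functionT R M).
Proof. exact: (@smooth_cst U 0). Qed.

Lemma smoothN U f : open U -> smooth U f -> smooth U (- f).
Proof.
move=> oU hf; have -> : - f = cst (-1) * f.
  by apply/funext => p; exact/esym/(mulN1r (f p)).
exact: smoothM oU (@smooth_cst U (-1)) hf.
Qed.

Lemma smoothB U f g : open U -> smooth U f -> smooth U g -> smooth U (f - g).
Proof. move=> oU hf hg; exact: smoothD oU hf (smoothN oU hg). Qed.

Lemma smooth_sum U (I : Type) (r : seq I) (Q : pred I)
    (F : I -> functionT R M) : open U ->
  (forall i, Q i -> smooth U (F i)) -> smooth U (\sum_(i <- r | Q i) F i).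
Proof.
move=> oU hF; apply: (big_ind (smooth U)); last exact: hF.
  exact: smooth0.
by move=> f g; exact: smoothD.
Qed.

End Smooth.

(** * Formal power series *)

Section Convolution.
Variable V : nmodType.
Implicit Types (F : nat -> nat -> V) (G : nat -> nat -> nat -> V).

(** Every [cauchy] product (functions, scalings, brackets, forms applied to fields) is an instance
    by conversion, so one set of rearrangement lemmas serves all of them. *)
Definition conv F k : V := \sum_(i < k.+1) F i (k - i)%N.

Lemma eq_conv F F' k :
  (forall i j, (i + j)%N = k -> F i j = F' i j) -> conv F k = conv F' k.
Proof. by move=> FF'; apply: eq_bigr => i _; rewrite FF' // subnKC -1?ltnS. Qed.

(** Summation over a square with a condition on the pair is symmetric in the two indices, unlike
    [k - i]; the free side [n] lets nested sums share one range. *)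
Lemma convE n F k : (k < n)%N ->
  conv F k = \sum_(i < n) \sum_(j < n | (i + j)%N == k) F i j.
Proof.
move=> kn; rewrite /conv (big_ord_widen _ (fun i => F i (k - i)%N) kn).
rewrite [RHS](bigID (fun i : 'I_n => (i < k.+1)%N)) /= [X in _ + X]big1.
  rewrite addr0; apply: eq_bigr => i; rewrite ltnS => ik.
  rewrite (big_pred1 (Ordinal (leq_ltn_trans (leq_subr i k) kn))) // => j.
  rewrite /=; apply/eqP/eqP => [ijk|->]; last exact: subnKC.
  by apply: val_inj => /=; rewrite -ijk addKn.
move=> i; rewrite ltnS -ltnNge => ki; apply: big1 => j /eqP ijk.
by move: ki; rewrite -ijk ltnNge leq_addr.
Qed.

Lemma convC F k : conv F k = conv (fun i j => F j i) k.
Proof.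
rewrite !(convE _ (ltnSn k)) (exchange_big_dep predT) //=.
by apply: eq_bigr => j _; apply: eq_bigl => i; rewrite addnC.
Qed.

(** Both sides are the sum over the triples with a + b + c = k. Only the left nesting is unfolded,
    by [red]; [convC] turns the right one into a left nesting of the permuted summand. *)
Lemma convA G k :
  conv (fun i c => conv (fun a b => G a b c) i) k =
  conv (fun a j => conv (fun b c => G a b c) j) k.
Proof.
pose n := k.+1.
have red (H : nat -> nat -> nat -> V) :
    conv (fun i c => conv (fun a b => H a b c) i) k =
    \sum_(c < n) \sum_(a < n) \sum_(b < n | (a + b + c)%N == k) H a b c.
  rewrite convC (convE _ (ltnSn k)); apply: eq_bigr => c _.
  transitivity (\sum_(i < n | (c + i)%N == k)
      \sum_(a < n) \sum_(b < n | (a + b)%N == i) H a b c).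
    by apply: eq_bigr => i _; rewrite (convE _ (ltn_ord i)).
  rewrite (exchange_big_dep predT) //=; apply: eq_bigr => a _.
  rewrite (exchange_big_dep (fun b : 'I_n => (a + b + c)%N == k)) /=.
    apply: eq_bigr => b /eqP abc.
    have abn : (a + b < n)%N by rewrite ltnS -abc leq_addr.
    rewrite (big_pred1 (Ordinal abn)) // => i /=.
    apply/andP/eqP => [[_ /eqP abi]|->]; first exact/val_inj/esym.
    by rewrite /= addnC abc !eqxx.
  by move=> i b /andP[/eqP cik _] /eqP abi; rewrite abi addnC cik.
rewrite red convC; rewrite (red (fun b c a => G a b c)).
transitivity (\sum_(a < n) \sum_(c < n) \sum_(b < n | (a + b + c)%N == k) G a b
  c).
  exact: exchange_big.
apply: eq_bigr => a _; rewrite (exchange_big_dep predT) //=.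
by apply: eq_bigr => b _; apply: eq_bigl => c; rewrite -addnA addnC.
Qed.

Lemma convD F F' k : conv (fun i j => F i j + F' i j) k = conv F k + conv F' k.
Proof. exact: big_split. Qed.

Lemma conv_sum (I : Type) (r : seq I) (Q : pred I) (F : I -> nat -> nat ->
  V) k :
  conv (fun i j =>
    \sum_(x <- r | Q x) F x i j) k = \sum_(x <- r | Q x) conv (F x) k.
Proof. exact: exchange_big. Qed.

End Convolution.

Lemma convN (V : zmodType) (F : nat -> nat -> V) k :
  conv (fun i j => - F i j) k = - conv F k.
Proof. by rewrite /conv sumrN. Qed.

(** * The commutative ring of formal power series *)

Section FormalSeriesRing.
Variable A : comNzRingType.

(** A separate name for [nat -> A], which keeps the pointwise addition but leaves multiplication
    free for the Cauchy product. *)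
Definition fps := nat -> A.
HB.instance Definition _ := GRing.Zmodule.copy fps (nat -> A).

Definition fps1 : fps := fun k => (k == 0%N)%:R.
Definition fps_mul (a b : fps) : fps := conv (fun i j => a i * b j).

Fact fps_mulC : commutative fps_mul.
Proof.
move=> a b; apply/funext => k; rewrite /fps_mul convC.
by apply: eq_conv => i j _; rewrite mulrC.
Qed.

Fact fps_mulA : associative fps_mul.
Proof.
move=> a b c; apply/funext => k.
transitivity (conv (fun i j => conv (fun u v => a i * b u * c v) j) k).
  apply: eq_conv => i j _; rewrite /fps_mul /conv mulr_sumr.
  by apply: eq_bigr => u _; rewrite mulrA.
rewrite -(convA (fun i u v => a i * b u * c v)).
by apply: eq_conv => i j _; rewrite /fps_mul /conv mulr_suml.
Qed.

Fact fps_mul1 : left_id fps1 fps_mul.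
Proof.
move=> a; apply/funext => k; rewrite /fps_mul /conv big_ord_recl /= subn0.
by rewrite /fps1 mul1r big1 ?addr0 // => i _; rewrite mul0r.
Qed.

Fact fps_mulDl : left_distributive fps_mul +%R.
Proof.
move=> a b c; apply/funext => k; rewrite [RHS]/(_ + _) /= -[RHS]convD.
by apply: eq_conv => i j _; rewrite -mulrDl.
Qed.

Fact fps1_neq0 : fps1 != 0.
Proof.
apply/eqP => /(congr1 (fun f : fps => f 0%N)) /eqP.
by rewrite /fps1 oner_eq0.
Qed.

HB.instance Definition _ := GRing.Zmodule_isComNzRing.Build fps
  fps_mulA fps_mulC fps_mul1 fps_mulDl fps1_neq0.

Lemma fps_sumE (I : Type) (r : seq I) (Q : pred I) (F : I -> fps) k :
  (\sum_(i <- r | Q i) F i) k = \sum_(i <- r | Q i) F i k.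
Proof. exact: (big_morph (fun f : fps => f k)). Qed.

End FormalSeriesRing.

(** * Vector fields and 1-forms *)

Section OpenSets.
Variable T : topologicalType.
Implicit Types U V W : set T.

Lemma opensub_refl U : open U -> opensub U U.
Proof. by move=> oU; split. Qed.

Lemma opensub_trans U V W : opensub U V -> opensub V W -> opensub U W.
Proof. by move=> [_ VU] [oW WV]; split=> // p /WV /VU. Qed.

Lemma opensubIl U V : open U -> open V -> opensub U (U `&` V).
Proof. by move=> oU oV; split; [exact: openI | exact: subIsetl]. Qed.

Lemma opensubIr U V : open U -> open V -> opensub V (U `&` V).
Proof. by move=> oU oV; split; [exact: openI | exact: subIsetr]. Qed.

End OpenSets.

Section Sections.
Variables (R : realType) (m : nat) (M : smoothManifold R m).
Local Notation C := R[i].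
Implicit Types (U V W : set M) (f g : functionT R M) (X Y Z : vfieldT R M).
Implicit Types (alpha beta : form1T R M).

Lemma vfield_sub U V X : opensub U V -> is_vfield U X -> is_vfield V X.
Proof. by move=> UV hX W /(opensub_trans UV); exact: hX. Qed.

Lemma form1_sub U V alpha : opensub U V -> is_form1 U alpha -> is_form1 V alpha.
Proof. by move=> UV h W /(opensub_trans UV); exact: h. Qed.

Section VectorField.
Variables (V : set M) (X : vfieldT R M).
Hypotheses (oV : open V) (hX : is_vfield V X).

Lemma vfield_smooth f : smooth V f -> smooth V (X f).
Proof. by have [h _ _ _] := hX (opensub_refl oV); exact: h. Qed.

Lemma vfield_eq f g p : smooth V f -> eq_fun V f g -> V p -> X f p = X g p.
Proof. by have [_ h _ _] := hX (opensub_refl oV) => sf fg; exact: h. Qed.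

Lemma vfieldD f g p : smooth V f -> smooth V g -> V p ->
  X (f + g) p = X f p + X g p.
Proof.
have [_ _ h _] := hX (opensub_refl oV) => sf sg Vp.
have -> : f + g = cst 1 * f + g.
  by apply/funext => q; exact/esym/(congr1 (fun z => z + g q))/(mul1r (f q)).
rewrite (h 1 f g sf sg p Vp).
exact: (congr1 (fun z => z + X g p)) (mul1r (X f p)).
Qed.

Lemma vfieldM f g p : smooth V f -> smooth V g -> V p ->
  X (f * g) p = X f p * g p + f p * X g p.
Proof. by have [_ _ _ h] := hX (opensub_refl oV) => sf sg; exact: h. Qed.

Lemma vfield0 p : V p -> X 0 p = 0.
Proof.
move=> Vp; have /esym := vfieldD (smooth0 V) (smooth0 V) Vp.
by rewrite addr0 -[RHS]addr0 => /addrI.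
Qed.

Lemma vfieldN f p : smooth V f -> V p -> X (- f) p = - X f p.
Proof.
move=> sf Vp; apply/eqP; rewrite -addr_eq0 addrC.
by rewrite -(vfieldD sf (smoothN oV sf) Vp) subrr (vfield0 Vp).
Qed.

Lemma vfieldB f g p : smooth V f -> smooth V g -> V p ->
  X (f - g) p = X f p - X g p.
Proof.
by move=> sf sg Vp; rewrite (vfieldD sf (smoothN oV sg) Vp) (vfieldN sg Vp).
Qed.

Lemma vfield_sum (I : Type) (r : seq I) (F : I -> functionT R M) p :
  (forall i, smooth V (F i)) -> V p ->
  X (\sum_(i <- r) F i) p = \sum_(i <- r) X (F i) p.
Proof.
move=> sF Vp; elim: r => [|i r IHr]; first by rewrite !big_nil (vfield0 Vp).
have sr := smooth_sum r oV (fun i (_ : predT i) => sF i).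
by rewrite !big_cons (vfieldD (sF i) sr Vp) IHr.
Qed.

End VectorField.

Lemma is_vfield0 U : is_vfield U (0 : vfieldT R M).
Proof.
move=> V [oV VU]; split=> [f _|f g _ _ p _|a f g _ _ p _|f g _ _ p _].
- exact: smooth0.
- by [].
- by rewrite /= !fctE /= mulr0 addr0.
- by rewrite !fctE /= mul0r mulr0 addr0.
Qed.

Lemma is_vfieldD U X Y : is_vfield U X -> is_vfield U Y -> is_vfield U (X + Y).
Proof.
move=> hX hY V UV; have [oV VU] := UV.
have [sX eX lX mX] := hX V UV; have [sY eY lY mY] := hY V UV.
split=> [f sf|f g sf fg p Vp|a f g sf sg p Vp|f g sf sg p Vp].
- exact: smoothD oV (sX f sf) (sY f sf).
- by rewrite -[LHS]/(X f p + Y f p) (eX f g sf fg p Vp) (eY f g sf fg p Vp).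
- rewrite -[LHS]/(X _ p + Y _ p) (lX a f g sf sg p Vp) (lY a f g sf sg p Vp).
  by rewrite !fctE /=; ring.
- rewrite -[LHS]/(X _ p + Y _ p) (mX f g sf sg p Vp) (mY f g sf sg p Vp).
  by rewrite !fctE /=; ring.
Qed.

Lemma is_vfield_scale U f X : smooth U f -> is_vfield U X ->
  is_vfield U (scale f X).
Proof.
move=> sf hX V UV; have [oV VU] := UV; have [sX eX lX mX] := hX V UV.
have {}sf := smooth_sub VU sf.
split=> [g sg|g h sg gh p Vp|a g h sg sh p Vp|g h sg sh p Vp].
- exact: smoothM oV sf (sX g sg).
- by rewrite -[LHS]/(f p * X g p) (eX g h sg gh p Vp).
- rewrite -[LHS]/(f p * X _ p) (lX a g h sg sh p Vp).
  by rewrite /scale !fctE /=; ring.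
- rewrite -[LHS]/(f p * X _ p) (mX g h sg sh p Vp).
  by rewrite /scale !fctE /=; ring.
Qed.

Lemma is_vfield_sum U (I : Type) (r : seq I) (Q : pred I) (F : I ->
  vfieldT R M) :
  (forall i, is_vfield U (F i)) -> is_vfield U (\sum_(i <- r | Q i) F i).
Proof.
move=> hF; apply: (big_ind (is_vfield U)); first exact: is_vfield0.
  by move=> X Y; exact: is_vfieldD.
by move=> i _; exact: hF.
Qed.

Lemma is_vfield_bracket U X Y : is_vfield U X -> is_vfield U Y ->
  is_vfield U (bracket X Y).
Proof.
move=> hX hY V UV; have [oV VU] := UV.
have {}hX := vfield_sub UV hX; have {}hY := vfield_sub UV hY.
have sX f := vfield_smooth oV hX (f := f).
have sY f := vfield_smooth oV hY (f := f).
have [_ _ lX mX] := hX V (opensub_refl oV).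
have [_ _ lY mY] := hY V (opensub_refl oV).
split=> [f sf|f g sf fg p Vp|a f g sf sg p Vp|f g sf sg p Vp].
- exact: smoothB oV (sX _ (sY _ sf)) (sY _ (sX _ sf)).
- have eX : eq_fun V (X f) (X g) by move=> q; exact: (vfield_eq oV hX sf fg).
  have eY : eq_fun V (Y f) (Y g) by move=> q; exact: (vfield_eq oV hY sf fg).
  rewrite -[LHS]/(X (Y f) p - Y (X f) p).
  by rewrite (vfield_eq oV hX (sY f sf) eY Vp) (vfield_eq oV hY (sX f sf) eX
    Vp).
- have sfg : smooth V (cst a * f + g).
    exact: smoothD oV (smoothM oV (smooth_cst V a) sf) sg.
  rewrite -[LHS]/(X (Y _) p - Y (X _) p).
  rewrite (vfield_eq oV hX (sY _ sfg) (lY a f g sf sg) Vp).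
  rewrite (vfield_eq oV hY (sX _ sfg) (lX a f g sf sg) Vp).
  rewrite (lX a (Y f) (Y g) (sY f sf) (sY g sg) p Vp).
  rewrite (lY a (X f) (X g) (sX f sf) (sX g sg) p Vp).
  by rewrite /bracket !fctE /=; ring.
- have sfg : smooth V (f * g) by exact: smoothM oV sf sg.
  rewrite -[LHS]/(X (Y _) p - Y (X _) p).
  rewrite (vfield_eq oV hX (sY _ sfg) (mY f g sf sg) Vp).
  rewrite (vfield_eq oV hY (sX _ sfg) (mX f g sf sg) Vp).
  have [sXf sXg sYf sYg] := And4 (sX f sf) (sX g sg) (sY f sf) (sY g sg).
  rewrite (vfieldD oV hX (smoothM oV sYf sg) (smoothM oV sf sYg) Vp).
  rewrite (vfieldD oV hY (smoothM oV sXf sg) (smoothM oV sf sXg) Vp).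
  rewrite (vfieldM oV hX sYf sg Vp) (vfieldM oV hX sf sYg Vp).
  rewrite (vfieldM oV hY sXf sg Vp) (vfieldM oV hY sf sXg Vp).
  by rewrite /bracket !fctE /=; ring.
Qed.

Section Form1.
Variables (V : set M) (alpha : form1T R M).
Hypotheses (oV : open V) (ha : is_form1 V alpha).

Lemma form1_smooth X : is_vfield V X -> smooth V (alpha X).
Proof. by have [h _ _] := ha (opensub_refl oV); exact: h. Qed.

Lemma form1_eq X Y p : is_vfield V X -> eq_vfield V X Y -> V p ->
  alpha X p = alpha Y p.
Proof. by have [_ h _] := ha (opensub_refl oV) => hX XY; exact: h. Qed.

Lemma form1_linear f X Y p : smooth V f -> is_vfield V X -> is_vfield V Y ->
  V p -> alpha (scale f X + Y) p = f p * alpha X p + alpha Y p.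
Proof. by have [_ _ h] := ha (opensub_refl oV) => sf hX hY; exact: h. Qed.

Lemma form1_0 p : V p -> alpha 0 p = 0.
Proof.
move=> Vp.
have := form1_linear (smooth_cst V 1) (@is_vfield0 V) (@is_vfield0 V) Vp.
have -> : scale (cst 1) 0 + 0 = 0 :> vfieldT R M.
  apply/funext => f; apply/funext => q.
  by rewrite -[LHS]/(1 * 0 + 0) mulr0 addr0.
by rewrite /= mul1r -[LHS]addr0 => /addrI.
Qed.

End Form1.

Lemma is_form1_0 U : is_form1 U (0 : form1T R M).
Proof.
move=> V [oV VU]; split=> [X _|X Y _ _ p _|f X Y _ _ _ p _].
- exact: smooth0.
- by [].
- by rewrite !fctE /= mulr0 addr0.
Qed.

Lemma is_form1D U alpha beta : is_form1 U alpha -> is_form1 U beta ->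
  is_form1 U (alpha + beta).
Proof.
move=> ha hb V UV; have [oV VU] := UV.
have {}ha := form1_sub UV ha; have {}hb := form1_sub UV hb.
split=> [X hX|X Y hX XY p Vp|f X Y sf hX hY p Vp].
- exact: smoothD oV (form1_smooth oV ha hX) (form1_smooth oV hb hX).
- rewrite -[LHS]/(alpha X p + beta X p).
  by rewrite (form1_eq oV ha hX XY Vp) (form1_eq oV hb hX XY Vp).
- rewrite -[LHS]/(alpha _ p + beta _ p).
  rewrite (form1_linear oV ha sf hX hY Vp) (form1_linear oV hb sf hX hY Vp).
  by rewrite !fctE /=; ring.
Qed.

Lemma is_form1N U alpha : is_form1 U alpha -> is_form1 U (- alpha).
Proof.
move=> ha V UV; have [oV VU] := UV; have {}ha := form1_sub UV ha.
split=> [X hX|X Y hX XY p Vp|f X Y sf hX hY p Vp].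
- exact: smoothN oV (form1_smooth oV ha hX).
- by rewrite -[LHS]/(- alpha X p) (form1_eq oV ha hX XY Vp).
- rewrite -[LHS]/(- alpha _ p) (form1_linear oV ha sf hX hY Vp).
  by rewrite !fctE /=; ring.
Qed.

Lemma is_form1_sum U (I : Type) (r : seq I) (Q : pred I) (F : I -> form1T R M) :
  (forall i, is_form1 U (F i)) -> is_form1 U (\sum_(i <- r | Q i) F i).
Proof.
move=> hF; apply: (big_ind (is_form1 U)); first exact: is_form1_0.
  by move=> a b; exact: is_form1D.
by move=> i _; exact: hF.
Qed.

Lemma is_form1_d0 U f : smooth U f -> is_form1 U (@d0 R m M f).
Proof.
move=> sf V UV; have [oV VU] := UV; have {}sf := smooth_sub VU sf.
split=> [X hX|X Y hX XY p Vp|g X Y sg hX hY p Vp].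
- exact: (vfield_smooth oV hX sf).
- exact: (XY V f (opensub_refl oV) sf p Vp).
- by [].
Qed.

End Sections.

(** * Formal functions and vector fields *)

Section Formal.
Variables (R : realType) (m : nat) (M : smoothManifold R m).
Local Notation C := R[i].
Implicit Types (U V W : set M) (f g : formal (functionT R M)).
Implicit Types (X Y Z : formal (vfieldT R M)).

(** Evaluation at a point turns [fmul] into the product of [fps C], so identities between formal
    sections become identities in a commutative ring. *)
Definition ev (p : M) f : fps C := fun k => f k p.

Lemma feq_funP U f g :
  feq_fun U f g <-> forall p, U p -> ev p f = ev p g.
Proof.
split=> [fg p Up|fg k p Up]; first by apply/funext => k; exact: fg.
exact: (congr1 (fun h : fps C => h k) (fg p Up)).
Qed.

Lemma ev0 p : ev p 0 = 0. Proof. by []. Qed.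
Lemma evD p f g : ev p (f + g) = ev p f + ev p g. Proof. by []. Qed.
Lemma evN p f : ev p (- f) = - ev p f. Proof. by []. Qed.
Lemma evB p f g : ev p (f - g) = ev p f - ev p g. Proof. by []. Qed.
Lemma ev_sum p (I : Type) (r : seq I) (Q : pred I)
    (F : I -> formal (functionT R M)) :
  ev p (\sum_(i <- r | Q i) F i) = \sum_(i <- r | Q i) ev p (F i).
Proof. exact: (big_morph (ev p) (evD p) (ev0 p)). Qed.

Lemma conv_fctE p (F : nat -> nat -> functionT R M) k :
  conv F k p = conv (fun i j => F i j p) k.
Proof. by rewrite /conv fct_sumE. Qed.

Lemma evM p f g : ev p (fmul f g) = ev p f * ev p g.
Proof.
apply/funext => k.
by rewrite -[LHS]/(conv (fun i j => f i * g j) k p) conv_fctE.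
Qed.

(* The value on [z] of a formal family of maps, as opposed to its value [fapp]
   on a formal series. *)
Definition fat {T : Type} (A : formal (T -> functionT R M)) (z : T) :
  formal (functionT R M) := fun k => A k z.

Section Fat.
Variables (T : Type) (z : T) (p : M).
Implicit Types A B : formal (T -> functionT R M).

Lemma ev_fat0 : ev p (fat (0 : formal (T -> functionT R M)) z) = 0.
Proof. by []. Qed.
Lemma ev_fatD A B : ev p (fat (A + B) z) = ev p (fat A z) + ev p (fat B z).
Proof. by []. Qed.
Lemma ev_fatN A : ev p (fat (- A) z) = - ev p (fat A z).
Proof. by []. Qed.
Lemma ev_fat_sum (I : Type) (r : seq I) (Q : pred I)
    (F : I -> formal (T -> functionT R M)) :
  ev p (fat (\sum_(i <- r | Q i) F i) z) = \sum_(i <- r | Q i) ev p (fat (F i)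
    z).
Proof.
exact: (big_morph (fun A => ev p (fat A z)) (fun _ _ => erefl) erefl).
Qed.
Lemma ev_fatZ f A : ev p (fat (fscale f A) z) = ev p f * ev p (fat A z).
Proof.
rewrite -evM; congr (ev p _); apply/funext => k.
by rewrite /fat /fscale /cauchy fct_sumE.
Qed.
End Fat.

Section Fapp.
Variables (T : Type) (z : formal T) (p : M).
Implicit Types A B : formal (T -> functionT R M).

Lemma ev_fappE A k : ev p (fapp A z) k = conv (fun i j => A i (z j) p) k.
Proof. exact: (conv_fctE p (fun i j => A i (z j)) k). Qed.

Lemma ev_fapp0 : ev p (fapp (0 : formal (T -> functionT R M)) z) = 0.
Proof. by apply/funext => k; rewrite ev_fappE /conv big1. Qed.
Lemma ev_fappD A B : ev p (fapp (A + B) z) = ev p (fapp A z) + ev p (fapp B z).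
Proof. by apply/funext => k; rewrite ev_fappE convD -!ev_fappE. Qed.
Lemma ev_fappN A : ev p (fapp (- A) z) = - ev p (fapp A z).
Proof. by apply/funext => k; rewrite ev_fappE convN -ev_fappE. Qed.
Lemma ev_fapp_sum (I : Type) (r : seq I) (Q : pred I)
    (F : I -> formal (T -> functionT R M)) :
  ev p (fapp (\sum_(i <- r | Q i) F i) z) =
  \sum_(i <- r | Q i) ev p (fapp (F i) z).
Proof. exact: (big_morph (fun A => ev p (fapp A z)) ev_fappD ev_fapp0). Qed.
Lemma ev_fappZ f A : ev p (fapp (fscale f A) z) = ev p f * ev p (fapp A z).
Proof.
apply/funext => k; rewrite ev_fappE.
transitivity (conv (fun i c => conv (fun a b => f a p * A b (z c) p) i) k).
  by apply: eq_conv => i c _;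
    rewrite -(conv_fctE p (fun a b => f a * A b (z c)))
    /fscale /cauchy fct_sumE.
rewrite convA; apply: eq_conv => i j _; rewrite ev_fappE.
by rewrite /conv mulr_sumr.
Qed.
End Fapp.

Lemma ev_tconst1 p : ev p (tconst 1) = 1.
Proof. by apply/funext => -[|k]. Qed.

Lemma ev_tconstM p (f g : functionT R M) :
  ev p (tconst (f * g)) = ev p (tconst f) * ev p (tconst g).
Proof.
rewrite -evM; apply/funext => k.
rewrite -[RHS]/(conv (fun i j => tconst f i * tconst g j) k p) conv_fctE /conv.
rewrite big_ord_recl big1 ?addr0 => [|i _]; last by rewrite !fctE /= mul0r.
by case: k => [|k]; [|exact/esym/mulr0].
Qed.

Lemma ev_fat_tconst p (X : vfieldT R M) (f : functionT R M) :
  ev p (fat (tconst X) f) = ev p (tconst (X f)).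
Proof. by apply/funext => -[|k]. Qed.

Lemma fapp_tconst p (X : vfieldT R M) f k :
  ev p (fapp (tconst X) f) k = X (f k) p.
Proof.
rewrite ev_fappE /conv big_ord_recl subn0 big1 ?addr0 //.
Qed.

Lemma fsmoothD U f g : open U -> fsmooth U f -> fsmooth U g ->
  fsmooth U (f + g).
Proof. by move=> oU sf sg k; exact: (smoothD oU (sf k) (sg k)). Qed.

Lemma fsmoothN U f : open U -> fsmooth U f -> fsmooth U (- f).
Proof. by move=> oU sf k; exact: (smoothN oU (sf k)). Qed.

Lemma fsmooth0 U : fsmooth U 0.
Proof. by move=> k; exact: smooth0. Qed.

Lemma fsmooth_tconst U (f : functionT R M) : smooth U f -> fsmooth U (tconst f).
Proof. by move=> sf [|k]; [exact: sf | exact: smooth0]. Qed.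

Lemma fsmoothM U f g : open U -> fsmooth U f -> fsmooth U g ->
  fsmooth U (fmul f g).
Proof.
move=> oU sf sg k; apply: (smooth_sum _ oU) => i _.
exact: (smoothM oU (sf i) (sg (k - i)%N)).
Qed.

Lemma fsmooth_sum U (I : Type) (r : seq I) (Q : pred I)
    (F : I -> formal (functionT R M)) : open U ->
  (forall i, fsmooth U (F i)) -> fsmooth U (\sum_(i <- r | Q i) F i).
Proof.
move=> oU sF; apply: (big_ind (fsmooth U)); first exact: fsmooth0.
  by move=> f g; exact: fsmoothD.
by move=> i _; exact: sF.
Qed.

Lemma fsmooth_sub U V f : V `<=` U -> fsmooth U f -> fsmooth V f.
Proof. by move=> VU sf k; exact: (smooth_sub VU (sf k)). Qed.

Lemma fsmooth_fapp U X f : open U -> fvfield U X -> fsmooth U f ->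
  fsmooth U (fapp X f).
Proof.
move=> oU hX sf k; apply: (smooth_sum _ oU) => i _.
exact: (vfield_smooth oU (hX i) (sf (k - i)%N)).
Qed.

Lemma fvfield_sub U V X : opensub U V -> fvfield U X -> fvfield V X.
Proof. by move=> UV hX k; exact: (vfield_sub UV (hX k)). Qed.

Lemma fvfield0 U : fvfield U 0.
Proof. by move=> k; exact: is_vfield0. Qed.

Lemma fvfieldD U X Y : fvfield U X -> fvfield U Y -> fvfield U (X + Y).
Proof. by move=> hX hY k; exact: (is_vfieldD (hX k) (hY k)). Qed.

Lemma fvfield_sum U (I : Type) (r : seq I) (Q : pred I)
    (F : I -> formal (vfieldT R M)) :
  (forall i, fvfield U (F i)) -> fvfield U (\sum_(i <- r | Q i) F i).
Proof.
move=> hF; apply: (big_ind (fvfield U)); first exact: fvfield0.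
  by move=> X Y; exact: fvfieldD.
by move=> i _; exact: hF.
Qed.

Lemma fvfieldZ U f X : fsmooth U f -> fvfield U X -> fvfield U (fscale f X).
Proof.
move=> sf hX k; apply: is_vfield_sum => i.
exact: (is_vfield_scale (sf i) (hX (k - i)%N)).
Qed.

Lemma fvfield_bracket U X Y : fvfield U X -> fvfield U Y ->
  fvfield U (fbracket X Y).
Proof.
move=> hX hY k; apply: is_vfield_sum => i.
exact: (is_vfield_bracket (hX i) (hY (k - i)%N)).
Qed.

Lemma fvfield_tconst U (X : vfieldT R M) : is_vfield U X ->
  fvfield U (tconst X).
Proof. by move=> hX [|k]; [exact: hX | exact: is_vfield0]. Qed.

Section Derivation.
Variables (V : set M) (X : formal (vfieldT R M)) (p : M).
Hypotheses (oV : open V) (hX : fvfield V X) (Vp : V p).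

Lemma fappr_eq f g : fsmooth V f -> feq_fun V f g ->
  ev p (fapp X f) = ev p (fapp X g).
Proof.
move=> sf fg; apply/funext => k; rewrite !ev_fappE; apply: eq_conv => i j _.
exact: (vfield_eq oV (hX i) (sf j) (fg j) Vp).
Qed.

Lemma fapprD f g : fsmooth V f -> fsmooth V g ->
  ev p (fapp X (f + g)) = ev p (fapp X f) + ev p (fapp X g).
Proof.
move=> sf sg; apply/funext => k.
transitivity (conv (fun i j => X i (f j) p + X i (g j) p) k).
  rewrite ev_fappE; apply: eq_conv => i j _.
  exact: (vfieldD oV (hX i) (sf j) (sg j) Vp).
by rewrite convD -!ev_fappE.
Qed.

Lemma fappr0 : ev p (fapp X 0) = 0.
Proof.
apply/funext => k; rewrite ev_fappE /conv big1 // => i _.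
exact: (vfield0 oV (hX i) Vp).
Qed.

Lemma fappr_sum (I : Type) (r : seq I) (F : I -> formal (functionT R M)) :
  (forall i, fsmooth V (F i)) ->
  ev p (fapp X (\sum_(i <- r) F i)) = \sum_(i <- r) ev p (fapp X (F i)).
Proof.
move=> sF; elim: r => [|i r IHr]; first by rewrite !big_nil fappr0.
by rewrite !big_cons (fapprD (sF i) (fsmooth_sum r predT oV sF)) IHr.
Qed.

End Derivation.

Lemma fapp_bracket V X Y f p : open V -> fvfield V X -> fvfield V Y ->
  fsmooth V f -> V p ->
  ev p (fapp (fbracket X Y) f) =
  ev p (fapp X (fapp Y f)) - ev p (fapp Y (fapp X f)).
Proof.
move=> oV hX hY sf Vp.
have compE X' Y' : fvfield V X' -> fvfield V Y' -> forall k,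
    ev p (fapp X' (fapp Y' f)) k =
    conv (fun i j => conv (fun a b => X' i (Y' a (f b)) p) j) k.
  move=> hX' hY' k; rewrite ev_fappE; apply: eq_conv => i j _.
  apply: (vfield_sum oV (hX' i)) => // a.
  exact: (vfield_smooth oV (hY' a) (sf (j - a)%N)).
apply/funext => k.
rewrite [RHS]/(ev p (fapp X (fapp Y f)) k - ev p (fapp Y (fapp X f)) k).
rewrite (compE X Y hX hY) (compE Y X hY hX) ev_fappE.
(* Reassociation sums the indices of the two fields first, as [fbracket] does; in the second term
   these two indices are exchanged at the end by [convC]. *)
rewrite -(convA (fun i a b => X i (Y a (f b)) p)).
rewrite -(convA (fun i a b => Y i (X a (f b)) p)).
transitivity (conv (fun i j => conv (fun a b => X a (Y b (f j)) p) i -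
    conv (fun a b => Y a (X b (f j)) p) i) k); last by rewrite convD convN.
apply: eq_conv => i j _.
transitivity (conv (fun a b => X a (Y b (f j)) p - Y b (X a (f j)) p) i).
  by rewrite /conv /fbracket /cauchy !fct_sumE.
by rewrite convD convN; congr (_ - _); exact: convC.
Qed.

Lemma feq_vfield_refl U X : feq_vfield U X X.
Proof. by move=> k V f. Qed.

Lemma feq_vfield_trans U X Y Z :
  feq_vfield U X Y -> feq_vfield U Y Z -> feq_vfield U X Z.
Proof.
move=> XY YZ k V f UV sf p Vp.
by rewrite (XY k V f UV sf p Vp) (YZ k V f UV sf p Vp).
Qed.

Lemma feq_vfieldI U X Y :
  (forall V (f : functionT R M) p, opensub U V -> smooth V f -> V p ->
     ev p (fat X f) = ev p (fat Y f)) -> feq_vfield U X Y.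
Proof.
move=> XY k V f UV sf p Vp.
exact: (congr1 (fun h : fps C => h k) (XY V f p UV sf Vp)).
Qed.

Lemma feq_vfield_fat U V X Y (f : functionT R M) p : feq_vfield U X Y ->
  opensub U V -> smooth V f -> V p -> ev p (fat X f) = ev p (fat Y f).
Proof.
by move=> XY UV sf Vp; apply/funext => k; exact: (XY k V f UV sf p Vp).
Qed.

Lemma feq_vfield_fapp U V X Y f p : feq_vfield U X Y ->
  opensub U V -> fsmooth V f -> V p -> ev p (fapp X f) = ev p (fapp Y f).
Proof.
move=> XY UV sf Vp; apply/funext => k; rewrite !ev_fappE.
by apply: eq_conv => i j _; exact: (XY i V (f j) UV (sf j) p Vp).
Qed.

End Formal.

(** * Formal 1-forms and nondegeneracy *)

Section FormalForms.
Variables (R : realType) (m : nat) (M : smoothManifold R m).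
Local Notation C := R[i].
Implicit Types (U V W : set M) (X Y : formal (vfieldT R M)) (Z : vfieldT R M).
Implicit Types (alpha beta : formal (form1T R M)).

Lemma feq_form1I U alpha beta :
  (forall V Z p, opensub U V -> is_vfield V Z -> V p ->
     ev p (fat alpha Z) = ev p (fat beta Z)) -> feq_form1 U alpha beta.
Proof.
move=> ab k V Z UV hZ p Vp.
exact: (congr1 (fun h : fps C => h k) (ab V Z p UV hZ Vp)).
Qed.

Lemma feq_form1_fat U V alpha beta Z p : feq_form1 U alpha beta ->
  opensub U V -> is_vfield V Z -> V p -> ev p (fat alpha Z) = ev p (fat beta Z).
Proof.
by move=> ab UV hZ Vp; apply/funext => k; exact: (ab k V Z UV hZ p Vp).
Qed.

Lemma feq_form1_fapp U V alpha beta X p : feq_form1 U alpha beta ->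
  opensub U V -> fvfield V X -> V p -> ev p (fapp alpha X) = ev p (fapp beta X).
Proof.
move=> ab UV hX Vp; apply/funext => k; rewrite !ev_fappE.
by apply: eq_conv => i j _; exact: (ab i V (X j) UV (hX j) p Vp).
Qed.

Lemma fapp_form1_tconst V alpha Z p : open V -> fform1 V alpha -> V p ->
  ev p (fapp alpha (tconst Z)) = ev p (fat alpha Z).
Proof.
move=> oV ha Vp; apply/funext => k; rewrite ev_fappE convC.
rewrite /conv big_ord_recl subn0 big1 ?addr0 // => i _.
exact: (form1_0 oV (ha _) Vp).
Qed.

Lemma fapp_fd0 (x : formal (functionT R M)) X p :
  ev p (fapp (fd0 x) X) = ev p (fapp X x).
Proof. by apply/funext => k; rewrite !ev_fappE convC. Qed.

Section Pairing.
Variable omega : formal (form2T R M).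
Hypothesis homega : fform2 setT omega.

Lemma form2l k V Z : open V -> is_vfield V Z -> is_form1 V (omega k Z).
Proof. by move=> oV hZ; have [] := homega k (conj oV (@subsetT _ V)) hZ. Qed.

Lemma form2r k V Z : open V -> is_vfield V Z ->
  is_form1 V (fun Z' => omega k Z' Z).
Proof. by move=> oV hZ; have [] := homega k (conj oV (@subsetT _ V)) hZ. Qed.

Lemma fform1_fapp V X : open V -> fvfield V X -> fform1 V (fapp omega X).
Proof.
move=> oV hX k; apply: is_form1_sum => i /=.
exact: (form2l _ oV (hX (k - i)%N)).
Qed.

(** Isolates the one term that contains [X k]: it is paired with [omega 0], the coefficient assumed
    nondegenerate, and the rest involves lower coefficients of [X]. *)
Lemma fappS X k Z p : fapp omega X k Z p =
  omega 0%N (X k) Z p + \sum_(i < k) omega i.+1 (X (k - i.+1)%N) Z p.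
Proof. by rewrite /fapp /cauchy !fct_sumE big_ord_recl subn0. Qed.

Hypothesis nondeg : nondegenerate (omega 0%N).

(** Strong induction on the coefficient: when the lower ones agree, all terms cancel except those
    with [omega 0]. *)
Lemma fnondegenerate_inj V X Y : open V -> fvfield V X -> fvfield V Y ->
  feq_form1 V (fapp omega X) (fapp omega Y) -> feq_vfield V X Y.
Proof.
move=> oV hX hY XY; elim/ltn_ind => k IHk.
(* The uniqueness clause compares fields only with the solution [W] that comes with it, so [X k] and
   [Y k] are both compared with [W]. *)
have [W [hW eW uW]] := nondeg oV (form2l 0 oV (hY k)).
have WY : eq_vfield V W (Y k) by apply: (uW _ (hY k)) => V' Z _ _ p _.
have WX : eq_vfield V W (X k).
  apply: (uW _ (hX k)) => V' Z VV' hZ p V'p; have [oV' V'V] := VV'.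
  have := XY k V' Z VV' hZ p V'p; rewrite !fappS.
  have -> : \sum_(i < k) omega i.+1 (X (k - i.+1)%N) Z p =
            \sum_(i < k) omega i.+1 (Y (k - i.+1)%N) Z p.
    apply: eq_bigr => i _.
    have hXi := vfield_sub VV' (hX (k - i.+1)%N).
    apply: (form1_eq oV' (form2r i.+1 oV' hZ) hXi) => // V'' f V'V'' sf.
    have ltk : (k - i.+1 < k)%N by rewrite ltn_subrL /= (leq_ltn_trans _
      (ltn_ord i)).
    exact: (IHk _ ltk V'' f (opensub_trans VV' V'V'') sf).
  exact: addIr.
move=> V' f VV' sf p V'p.
by rewrite -(WX V' f VV' sf p V'p) (WY V' f VV' sf p V'p).
Qed.

(** The equation is solved order by order: at order [k] it prescribes the form [omega 0 (X k)] in
    terms of [alpha k] and the coefficients of [X] already found. *)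
Lemma fnondegenerate_surj V alpha : open V -> fform1 V alpha ->
  exists2 X, fvfield V X & feq_form1 V (fapp omega X) alpha.
Proof.
move=> oV ha.
(* The recursion needs a function where nondegeneracy asserts existence; the default 0 is taken only
   when [b] has no preimage. *)
pose sharp (b : form1T R M) : vfieldT R M :=
  xget 0 [set X | is_vfield V X /\ eq_form1 V (omega 0%N X) b].
have sharpP b : is_form1 V b ->
    is_vfield V (sharp b) /\ eq_form1 V (omega 0%N (sharp b)) b.
  move=> hb; have [X [hX eX _]] := nondeg oV hb.
  by rewrite /sharp; case: xgetP => [Y _ //|/(_ X)[]]; split.
pose rhs k (X : formal (vfieldT R M)) : form1T R M :=
  alpha k - \sum_(i < k) omega i.+1 (X (k - i.+1)%N).
(* Course-of-values recursion: [xs k] lists the first [k] coefficients. The default of [nth] is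
   never reached, as [rhs k] reads only indices below [k]. *)
pose xs := fix xs k : seq (vfieldT R M) :=
  if k is k'.+1 then rcons (xs k') (sharp (rhs k' (nth 0 (xs k')))) else [::].
have size_xs k : size (xs k) = k by elim: k => //= k; rewrite size_rcons => ->.
pose X : formal (vfieldT R M) := fun k => nth 0 (xs k.+1) k.
have nthX n k : (k < n)%N -> nth 0 (xs n) k = X k.
  elim: n => // n IHn; rewrite ltnS leq_eqVlt => /predU1P[->//|kn].
  by rewrite /= nth_rcons size_xs kn IHn.
have XE k : X k = sharp (rhs k X).
  rewrite /X /= nth_rcons size_xs ltnn eqxx /rhs; congr (sharp (_ - _)).
  apply: eq_bigr => i _; rewrite nthX //.
  by rewrite ltn_subrL /= (leq_ltn_trans _ (ltn_ord i)).
have hX : fvfield V X.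
  elim/ltn_ind => k IHk; rewrite XE; apply: (sharpP _ _).1.
  apply: is_form1D (ha k) (is_form1N _); rewrite (_ : \sum_(i < k) _ =
    \sum_(i < k) omega i.+1 (nth 0 (xs k) (k - i.+1)%N)).
    apply: is_form1_sum => i; rewrite nthX; last first.
      by rewrite ltn_subrL /= (leq_ltn_trans _ (ltn_ord i)).
    apply: (form2l _ oV); apply: IHk.
    by rewrite ltn_subrL /= (leq_ltn_trans _ (ltn_ord i)).
  apply: eq_bigr => i _; rewrite nthX //.
  by rewrite ltn_subrL /= (leq_ltn_trans _ (ltn_ord i)).
exists X => // k V' Z VV' hZ p V'p.
have hr : is_form1 V (rhs k X).
  apply: is_form1D (ha k) (is_form1N _); apply: is_form1_sum => i.
  exact: (form2l _ oV (hX _)).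
rewrite fappS {1}XE ((sharpP _ hr).2 V' Z VV' hZ p V'p).
by rewrite /rhs !fctE !fct_sumE subrK.
Qed.

End Pairing.
End FormalForms.

(** * Darboux frames *)

Section Frames.
Variables (R : realType) (m : nat) (M : smoothManifold R m).
Local Notation C := R[i].
Variable P : set M -> set (formal (vfieldT R M)).

(* A basis [e] of the polarization over [U] whose coordinate functionals are
   [X |-> X (y i)]. *)
Record local_frame U n (e : 'I_n -> formal (vfieldT R M))
    (y : 'I_n -> formal (functionT R M)) : Prop := LocalFrame {
  frame_open : open U;
  frame_in : forall i, P U (e i);
  frame_smooth : forall i, fsmooth U (y i);
  frame_dual : forall i j p, U p -> ev p (fapp (e i) (y j)) = (i == j)%:R;
  frame_span : forall V X, opensub U V -> P V X ->
    feq_vfield V X (\sum_i fscale (fapp X (y i)) (e i)) }.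

Definition flat_frame (nabla : formal (vfieldT R M) -> formal (vfieldT R M) ->
    formal (vfieldT R M)) U n (e : 'I_n -> formal (vfieldT R M)) : Prop :=
  forall V X i, opensub U V -> P V X -> feq_vfield V (nabla X (e i)) 0.

End Frames.

Section DarbouxFrame.
Variables (R : realType) (m : nat) (M : smoothManifold R m).
Local Notation C := R[i].
Variables (omega : formal (form2T R M))
  (P : set M -> set (formal (vfieldT R M))).
Hypothesis homega : fform2 setT omega.
Hypothesis nondeg : nondegenerate (omega 0%N).
Hypothesis Psub : is_subsheaf P.
Variables (U : set M) (n : nat) (x y : 'I_n -> formal (functionT R M)).
Hypothesis oU : open U.
Hypothesis xy : formal_coordinates U x y.
Hypothesis omega_xy :
  feq_form2 U omega (\sum_i fwedge (fd0 (y i)) (fd0 (x i))).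
Hypothesis P_x : forall V X, opensub U V -> fvfield V X ->
  (P V X <-> forall i, feq_fun V (fapp (fd0 (x i)) X) 0).

Implicit Types (V W : set M) (X Y : formal (vfieldT R M)) (Z : vfieldT R M).

Let sx i : fsmooth U (x i). Proof. by case: xy. Qed.
Let sy i : fsmooth U (y i). Proof. by case: xy. Qed.

(** The index [a] of a wedge is split into [u] and [v] for its two factors, and [b] is the index of
    the field. Grouping [b] with [u], the factor to which the field is applied, makes the triple sum
    a product of two series. *)
Let conv_mull (A : nat -> nat -> C) (B : fps C) k :
  conv (fun a b => conv (fun u v => A b u * B v) a) k =
  ((conv A : fps C) * B) k.
Proof.
transitivity (conv (fun a b => conv (fun v u => A b u * B v) a) k).
  by apply: eq_conv => a b _; exact: convC.
rewrite (convA (fun v u b => A b u * B v)) convC.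
rewrite -[RHS]/(conv (fun i j => conv A i * B j) k).
apply: eq_conv => i j _; rewrite convC /conv mulr_suml.
by [].
Qed.

Let conv_mulr (A : nat -> nat -> C) (B : fps C) k :
  conv (fun a b => conv (fun u v => B u * A b v) a) k =
  (B * (conv A : fps C)) k.
Proof.
rewrite (convA (fun u v b => B u * A b v)).
rewrite -[RHS]/(conv (fun i j => B i * conv A j) k).
apply: eq_conv => i j _; rewrite convC /conv mulr_sumr.
by [].
Qed.

Lemma pairing_darboux V X Z p : opensub U V -> fvfield V X -> is_vfield V Z ->
  V p -> ev p (fat (fapp omega X) Z) =
    \sum_i (ev p (fapp X (y i)) * ev p (fat (fd0 (x i)) Z) -
            ev p (fat (fd0 (y i)) Z) * ev p (fapp X (x i))).
Proof.
move=> UV hX hZ Vp; apply/funext => k.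
pose A (z : formal (functionT R M)) a u : C := X a (z u) p.
have fappA z : ev p (fapp X z) = conv (A z).
  by apply/funext => l; rewrite ev_fappE.
pose B (z : formal (functionT R M)) : fps C := ev p (fat (fd0 z) Z).
transitivity (conv (fun a b => omega a (X b) Z p) k).
  by rewrite -[LHS]/(fapp omega X k Z p) /fapp /cauchy !fct_sumE.
transitivity (conv (fun a b => \sum_i
    (conv (fun u v => A (y i) b u * B (x i) v) a -
     conv (fun u v => B (y i) u * A (x i) b v) a)) k).
  apply: eq_conv => a b _; rewrite (omega_xy a UV (hX b) hZ Vp).
  rewrite !fct_sumE; apply: eq_bigr => i _.
  rewrite -convN -convD.
  by rewrite /fwedge /cauchy !fct_sumE.
rewrite conv_sum fps_sumE; apply: eq_bigr => i _.
by rewrite convD convN conv_mull conv_mulr !fappA.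
Qed.

Section Hamiltonian.
Variable e : 'I_n -> formal (vfieldT R M).
Hypothesis he : forall i, fvfield U (e i).
Hypothesis e_x : forall i, feq_form1 U (fapp omega (e i)) (fd0 (x i)).

(** The form dx_i has two expansions in the basis dx_j, dy_j: the trivial one, [c2], and the one
    with coefficients e_i(y_j) and -e_i(x_j), [c1], obtained by contracting the Darboux form with
    [e i]. Coefficients in a basis are unique. *)
Lemma hamiltonian_coord i j p : U p ->
  ev p (fapp (e i) (y j)) = (i == j)%:R /\ ev p (fapp (e i) (x j)) = 0.
Proof.
move=> Up; have [_ _ [_ basis_xy]] := xy.
have hdx : fform1 U (fd0 (x i)) by move=> k; exact: (is_form1_d0 (sx i k)).
have [c [_ _ uniq_c]] := basis_xy U (fd0 (x i)) (opensub_refl oU) hdx.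
pose c1 (t : 'I_n + 'I_n) : formal (functionT R M) :=
  match t with inl j => fapp (e i) (y j) | inr j => - fapp (e i) (x j) end.
pose c2 (t : 'I_n + 'I_n) : formal (functionT R M) :=
  match t with inl j => if i == j then tconst 1 else 0 | inr j => 0 end.
have sc1 t : fsmooth U (c1 t).
  case: t => l; first exact: (fsmooth_fapp oU (he i) (sy l)).
  exact: (fsmoothN oU (fsmooth_fapp oU (he i) (sx l))).
have sc2 t : fsmooth U (c2 t).
  case: t => l; last exact: fsmooth0.
  rewrite /c2; case: eqP => _; last exact: fsmooth0.
  exact: (fsmooth_tconst (smooth_cst U 1)).
have cc1 := uniq_c c1 sc1; have {uniq_c} cc2 := uniq_c c2 sc2.
have ev_c2 q l : ev q (c2 (inl l)) = (i == l)%:R.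
  by rewrite /c2; case: eqP => _; rewrite ?ev_tconst1.
have {}cc1 t : ev p (c t) = ev p (c1 t).
  apply: ((feq_funP _ _ _).1 (cc1 _ t)) Up.
  apply: feq_form1I => V Z q UV hZ Vq.
  rewrite ev_fat_sum big_sumType /= -big_split /=.
  rewrite -(feq_form1_fat (e_x i) UV hZ Vq).
  rewrite (pairing_darboux UV (fvfield_sub UV (he i)) hZ Vq).
  apply: eq_bigr => l _; rewrite !ev_fatZ evN mulNr.
  by rewrite [X in _ - X = _]mulrC.
have {}cc2 t : ev p (c t) = ev p (c2 t).
  apply: ((feq_funP _ _ _).1 (cc2 _ t)) Up.
  apply: feq_form1I => V Z q UV hZ Vq.
  rewrite ev_fat_sum big_sumType /= [X in _ + X]big1 ?addr0 => [|l _].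
    rewrite (bigD1 i) //= big1 ?addr0 => [|l ne_li].
      by rewrite ev_fatZ (ev_c2 q i) eqxx mul1r.
    by rewrite ev_fatZ (ev_c2 q l) eq_sym (negbTE ne_li) mul0r.
  by rewrite ev_fatZ ev0 mul0r.
have c12 t : ev p (c1 t) = ev p (c2 t) by rewrite -cc1.
split; first by rewrite -(ev_c2 p j); exact: (c12 (inl j)).
by apply/eqP; rewrite -oppr_eq0 -evN (c12 (inr j)).
Qed.

(** For the spanning property, [X] and its candidate expansion are contracted with [omega]: their
    derivatives of the x_i vanish, those of the y_i agree by duality, and contraction is
    injective. *)
Lemma hamiltonian_frame : local_frame P U e y.
Proof.
split=> //.
- move=> i; apply/(P_x (opensub_refl oU) (he i)) => j.
  apply/feq_funP => p Up; rewrite fapp_fd0.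
  by have [_ ->] := hamiltonian_coord i j Up.
- by move=> i j p Up; have [] := hamiltonian_coord i j Up.
move=> V X UV PX; have [oV VU] := UV.
have hX : fvfield V X := subsheaf_vfield Psub oV PX.
have sc i : fsmooth V (fapp X (y i)).
  exact: (fsmooth_fapp oV hX (fsmooth_sub VU (sy i))).
have hS : fvfield V (\sum_i fscale (fapp X (y i)) (e i)).
  by apply: fvfield_sum => i; exact: (fvfieldZ (sc i) (fvfield_sub UV (he i))).
apply: (fnondegenerate_inj homega nondeg oV hX hS).
apply: feq_form1I => W Z p VW hZ Wp; have UW := opensub_trans UV VW.
have Up : U p by exact: UW.2.
rewrite (pairing_darboux UW (fvfield_sub VW hX) hZ Wp).
rewrite (pairing_darboux UW (fvfield_sub VW hS) hZ Wp).
apply: eq_bigr => i _; rewrite !ev_fapp_sum.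
have -> : ev p (fapp X (x i)) = 0.
  have /(P_x UV hX)/(_ i)/feq_funP/(_ p (VW.2 p Wp)) := PX.
  by rewrite fapp_fd0.
rewrite [X in _ = _ - _ * X]big1 => [|j _]; last first.
  by rewrite ev_fappZ (hamiltonian_coord j i Up).2 mulr0.
congr (_ * _ - _); rewrite (bigD1 i) //= big1 ?addr0 => [|j ne_ji].
  by rewrite ev_fappZ (hamiltonian_coord i i Up).1 eqxx mulr1.
by rewrite ev_fappZ (hamiltonian_coord j i Up).1 (negbTE ne_ji) mulr0.
Qed.

(* [omega (nabla_X e_i, Z) = X (Z x_i) - (nabla_X Z) x_i], which the absence of
   torsion turns into [Z (X x_i) - (nabla_Z X) x_i]; both terms vanish as [X] and
   [nabla_Z X] belong to [P]. *)
Lemma hamiltonian_flat nabla : symplectic_connection omega P nabla ->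
  flat_frame P nabla U e.
Proof.
move=> hn V X i UV PX; have [oV VU] := UV; have hc := sc_connection hn.
have hX : fvfield V X := subsheaf_vfield Psub oV PX.
have hne := conn_vfield hc oV hX (fvfield_sub UV (he i)).
have P_x0 W Y p : opensub U W -> P W Y -> W p -> ev p (fapp Y (x i)) = 0.
  move=> UW PY Wp; have hY := subsheaf_vfield Psub UW.1 PY.
  have /(P_x UW hY)/(_ i)/feq_funP/(_ p Wp) := PY.
  by rewrite fapp_fd0.
apply: (fnondegenerate_inj homega nondeg oV hne (@fvfield0 _ _ M V)).
apply: feq_form1I => W Z p VW hZ Wp; have UW := opensub_trans UV VW.
have [oW WV] := VW; have {}hX := fvfield_sub VW hX.
have {}PX : P W X := subsheaf_restrict Psub oV VW PX.
have heW := fvfield_sub UW (he i).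
have hZt := fvfield_tconst hZ; set Zt := tconst Z in hZt.
have sxW := fsmooth_sub UW.2 (sx i).
have hnXZ := conn_vfield hc oW hX hZt.
have hnZX := conn_vfield hc oW hZt hX.
rewrite (pairing_darboux UW (@fvfield0 _ _ M W) hZ Wp) [RHS]big1 => [|j _];
  last first.
  by rewrite !ev_fapp0 mul0r mulr0 subr0.
rewrite -(fapp_form1_tconst _ oW (fform1_fapp homega oW (fvfield_sub VW hne))
  Wp).
have omega_e Y q : fvfield W Y -> W q ->
    ev q (fpair2 omega (e i) Y) = ev q (fapp Y (x i)).
  by move=> hY Wq; rewrite /fpair2 (feq_form1_fapp (e_x i) UW hY Wq) fapp_fd0.
have /feq_funP/(_ p Wp) := sc_preserves_form hn oW hX heW hZt.
rewrite evD (omega_e _ _ hnXZ Wp).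
have eZ : feq_fun W (fapp Zt (x i)) (fpair2 omega (e i) Zt).
  by apply/feq_funP => q Wq; rewrite (omega_e _ _ hZt Wq).
rewrite -(fappr_eq oW hX Wp (fsmooth_fapp oW hZt sxW) eZ).
have := feq_vfield_fapp (sc_torsion_free hn oW hX hZt) (opensub_refl oW) sxW Wp.
rewrite ev_fappD ev_fappN (fapp_bracket oW hX hZt sxW Wp).
rewrite (P_x0 _ _ _ UW (sc_preserves_polarization hn oW hZt PX) Wp) subr0 => ->.
have eX : feq_fun W (fapp X (x i)) 0.
  by apply/feq_funP => q Wq; exact: (P_x0 _ _ _ UW PX Wq).
rewrite (fappr_eq oW hZt Wp (fsmooth_fapp oW hX sxW) eX) (fappr0 oW hZt Wp)
  subr0.
by move/eqP; rewrite -subr_eq subrr => /eqP.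
Qed.

End Hamiltonian.

End DarbouxFrame.

(** The connection is quantified after the frame, so that two connections can be compared in one
    frame that is flat for both. *)
Lemma polarized_frame (R : realType) (m : nat) (M : smoothManifold R m)
    (omega : formal (form2T R M)) (P : set M -> set (formal (vfieldT R M)))
    (p : M) :
  formal_polarized_symplectic omega P ->
  exists U n (e : 'I_n -> formal (vfieldT R M)) (y : 'I_n ->
    formal (functionT R M)),
  [/\ U p, local_frame P U e y &
      forall nabla, symplectic_connection omega P nabla ->
        flat_frame P nabla U e].
Proof.
move=> [hw _ nd [hP _ _ _] hd]; have [U [x [y [[oU Up] xy wxy Px]]]] := hd p.
have hdx i : fform1 U (fd0 (x i)).
  by move=> k; apply: is_form1_d0; have [sx _ _] := xy; exact: sx.
have /boolp.choice[e he] : forall i, exists X : formal (vfieldT R M),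
    fvfield U X /\ feq_form1 U (fapp omega X) (fd0 (x i)).
  move=> i; have [X] := fnondegenerate_surj hw nd oU (hdx i).
  by exists X.
have e1 i := (he i).1; have e2 i := (he i).2.
exists U, _, e, y; split=> //;
  first exact: (hamiltonian_frame hw nd hP oU xy wxy Px e1 e2).
move=> nabla; exact: (hamiltonian_flat hw nd hP xy wxy Px e1 e2).
Qed.

(** * Traces of endomorphisms of the polarization *)

Section Trace.
Variables (R : realType) (m : nat) (M : smoothManifold R m).
Local Notation C := R[i].
Variable P : set M -> set (formal (vfieldT R M)).
Hypothesis Psub : is_subsheaf P.
Hypothesis Pmod : is_submodule P.
Implicit Types (U V W : set M) (X Y Z : formal (vfieldT R M)).
Implicit Types (phi : formal (vfieldT R M) -> formal (vfieldT R M)).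

(** Linearity is asked on sections of [P] only, and up to equality of sections, because [phi] acts
    on arbitrary representatives. *)
Record P_linear V phi : Prop := PLinear {
  P_linear_in : forall W X, opensub V W -> P W X -> P W (phi X);
  P_linear_eq : forall W X Y, opensub V W -> P W X -> P W Y ->
    feq_vfield W X Y -> feq_vfield W (phi X) (phi Y);
  P_linear_lin : forall W f X Y, opensub V W -> fsmooth W f -> P W X ->
    P W Y -> feq_vfield W (phi (fscale f X + Y)) (fscale f (phi X) + phi Y) }.

Lemma P_sum V (I : Type) (r : seq I) (c : I -> formal (functionT R M))
    (e : I -> formal (vfieldT R M)) : open V ->
  (forall i, fsmooth V (c i)) -> (forall i, P V (e i)) ->
  P V (\sum_(i <- r) fscale (c i) (e i)).
Proof.
move=> oV sc Pe; have [P_0 P_D] := Pmod oV.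
elim: r => [|i r IHr]; first by rewrite big_nil.
rewrite big_cons; exact: (P_D _ _ _ (sc i) (Pe i) IHr).
Qed.

Lemma P_linear_sum V phi W (I : Type) (r : seq I)
    (c : I -> formal (functionT R M)) (e : I -> formal (vfieldT R M)) :
  P_linear V phi -> opensub V W ->
  (forall i, fsmooth W (c i)) -> (forall i, P W (e i)) ->
  feq_vfield W (phi (\sum_(i <- r) fscale (c i) (e i)))
    (\sum_(i <- r) fscale (c i) (phi (e i))).
Proof.
move=> hphi VW sc Pe; have oW := VW.1; have [P_0 P_D] := Pmod oW.
elim: r => [|i r IHr].
  rewrite !big_nil; apply: feq_vfieldI => W' f p WW' sf W'p.
  (* For the empty sum, phi(0) = 0 follows from 0 = 1 * 0 + 0, which gives phi(0) = phi(0) +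
     phi(0). *)
  have s1 : fsmooth W (tconst (cst 1 : functionT R M)).
    exact: (fsmooth_tconst (smooth_cst W 1)).
  have P_0' : P W (fscale (tconst (cst 1 : functionT R M)) 0 + 0).
    exact: (P_D _ _ _ s1 P_0 P_0).
  have E0 : feq_vfield W 0 (fscale (tconst (cst 1 : functionT R M)) 0 + 0).
    apply: feq_vfieldI => W'' g q _ _ _.
    by rewrite ev_fatD ev_fatZ !ev_fat0 mulr0 addr0.
  have h := feq_vfield_trans (P_linear_eq hphi VW P_0 P_0' E0)
    (P_linear_lin hphi VW s1 P_0 P_0).
  have := feq_vfield_fat h WW' sf W'p; rewrite ev_fatD ev_fatZ ev_tconst1 mul1r.
  by rewrite -[LHS]addr0 => /addrI <-.
rewrite !big_cons; apply: feq_vfield_trans (P_linear_lin hphi VW (sc i) (Pe i)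
  (P_sum r oW sc Pe)) _.
apply: feq_vfieldI => W' f p WW' sf W'p.
by rewrite !ev_fatD (feq_vfield_fat IHr WW' sf W'p).
Qed.

Section LocalFrame.
Variables (U : set M) (n : nat) (e : 'I_n -> formal (vfieldT R M))
  (y : 'I_n -> formal (functionT R M)).
Hypothesis frame : local_frame P U e y.

Lemma frame_vfield i : fvfield U (e i).
Proof. exact: (subsheaf_vfield Psub (frame_open frame) (frame_in frame i)). Qed.

Lemma frame_in_sub V i : opensub U V -> P V (e i).
Proof.
move=> UV.
exact: (subsheaf_restrict Psub (frame_open frame) UV (frame_in frame i)).
Qed.

Lemma frame_coord_smooth V X i : opensub U V -> fvfield V X ->
  fsmooth V (fapp X (y i)).
Proof.
move=> UV hX; apply: (fsmooth_fapp UV.1 hX).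
exact: (fsmooth_sub UV.2 (frame_smooth frame i)).
Qed.

Lemma frame_basis V : opensub U V -> is_basis P (@feq_vfield R m M) V e.
Proof.
move=> UV; split=> [i|W X VW PX]; first exact: frame_in_sub.
have UW := opensub_trans UV VW; have hX := subsheaf_vfield Psub UW.1 PX.
exists (fun i => fapp X (y i)); split=> [i||c sc eqX i].
- exact: (frame_coord_smooth i UW hX).
- exact: (frame_span frame UW PX).
apply/feq_funP => p Wp; have sy := fsmooth_sub UW.2 (frame_smooth frame i).
rewrite (feq_vfield_fapp eqX (opensub_refl UW.1) sy Wp) ev_fapp_sum.
rewrite (bigD1 i) //= big1 ?addr0 => [|j ne_ji].
  by rewrite ev_fappZ (frame_dual frame _ _ (UW.2 p Wp)) eqxx mulr1.
by rewrite ev_fappZ (frame_dual frame _ _ (UW.2 p Wp)) (negbTE ne_ji) mulr0.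
Qed.

(** Independence of the basis: with e_i = sum_j c_ij e'_j and e'_l = sum_i b_li e_i, the trace in
    the frame is the sum of a_lj b_li c_ij over i, j, l. The single relation sum_i b_li c_ij =
    delta_lj reduces it to the trace of [a], whatever the ranks [n] and [r]. *)
Lemma trace_frame V phi k p : open V -> P_linear V phi -> U p -> V p ->
  trace_on P phi k p = (\sum_i ev p (fapp (phi (e i)) (y i))) k.
Proof.
move=> oV hphi Up Vp; have oU := frame_open frame.
have UW := opensubIl oU oV; have VW := opensubIr oU oV.
rewrite /trace_on; apply: xget_unique.
  (* The frame itself is an admissible basis near [p], so the default value in [trace_on] is not
     taken. *)
  exists (U `&` V), n, e, (fun i j => fapp (phi (e j)) (y i)); split.
  - by split; [exact: UW.1 | split].
  - exact: (frame_basis UW).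
  - move=> i j; apply: (frame_coord_smooth _ UW).
    apply: (subsheaf_vfield Psub UW.1).
    exact: (P_linear_in hphi VW (frame_in_sub j UW)).
  - move=> j; apply: (frame_span frame UW).
    exact: (P_linear_in hphi VW (frame_in_sub j UW)).
  by rewrite fps_sumE.
move=> z [W [r [e' [a [[oW Wp] [Pe' basis'] sa phi_e' ->]]]]].
pose O := W `&` (U `&` V).
have WO : opensub W O := opensubIl oW UW.1.
have UO : opensub U O := opensub_trans UW (opensubIr oW UW.1).
have VO : opensub V O := opensub_trans VW (opensubIr oW UW.1).
have oO := UO.1; have Op : O p by [].
have Pe'O j : P O (e' j) := subsheaf_restrict Psub oW WO (Pe' j).
have PeO i : P O (e i) := frame_in_sub i UO.
have /boolp.choice[c hc] : forall i, exists c : 'I_r -> formal (functionT R M),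
    (forall j, fsmooth O (c j)) /\ feq_vfield O (e i) (\sum_j fscale (c j) (e'
      j)).
  by move=> i; have [c [sc eqc _]] := basis' O (e i) WO (PeO i); exists c.
have sc i j : fsmooth O (c i j) := (hc i).1 j.
have e_e' i := (hc i).2.
have sy i : fsmooth O (y i) := fsmooth_sub UO.2 (frame_smooth frame i).
have sb l i : fsmooth O (fapp (e' l) (y i)).
  exact: (frame_coord_smooth i UO (subsheaf_vfield Psub oO (Pe'O l))).
(* The field [e' l] is expanded in the basis [e'] twice: through the frame [e], with coefficients
   [d1], and trivially, with coefficients [d2]. *)
have inv l j : \sum_i ev p (fapp (e' l) (y i)) * ev p (c i j) = (l == j)%:R.
  have [d [_ _ uniq_d]] := basis' O (e' l) WO (Pe'O l).
  pose d1 j' : formal (functionT R M) :=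
    \sum_i fmul (fapp (e' l) (y i)) (c i j').
  pose d2 j' : formal (functionT R M) := if l == j' then tconst 1 else 0.
  have ev_d2 q j' : ev q (d2 j') = (l == j')%:R.
    by rewrite /d2; case: eqP => _; rewrite ?ev_tconst1.
  have sd1 j' : fsmooth O (d1 j').
    by apply: (fsmooth_sum _ _ oO) => i;
      exact: (fsmoothM oO (sb l i) (sc i j')).
  have sd2 j' : fsmooth O (d2 j').
    rewrite /d2; case: eqP => _; last exact: fsmooth0.
    exact: (fsmooth_tconst (smooth_cst O 1)).
  have dd1 : ev p (d j) = ev p (d1 j).
    apply: ((feq_funP _ _ _).1 (uniq_d d1 sd1 _ j)) Op.
    apply: feq_vfieldI => O' f q OO' sf O'q; have UO' := opensub_trans UO OO'.
    rewrite (feq_vfield_fat (frame_span frame UO (Pe'O l)) OO' sf O'q).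
    rewrite !ev_fat_sum.
    transitivity (\sum_i \sum_j' ev q (fapp (e' l) (y i)) *
        (ev q (c i j') * ev q (fat (e' j') f))).
      apply: eq_bigr => i _;
        rewrite ev_fatZ (feq_vfield_fat (e_e' i) OO' sf O'q).
      by rewrite ev_fat_sum mulr_sumr; apply: eq_bigr => j' _; rewrite ev_fatZ.
    rewrite exchange_big; apply: eq_bigr => j' _;
      rewrite ev_fatZ ev_sum mulr_suml.
    by apply: eq_bigr => i _; rewrite evM mulrA.
  have dd2 : ev p (d j) = ev p (d2 j).
    apply: ((feq_funP _ _ _).1 (uniq_d d2 sd2 _ j)) Op.
    apply: feq_vfieldI => O' f q OO' sf O'q; rewrite ev_fat_sum.
    rewrite (bigD1 l) //= big1 ?addr0 => [|j' ne_j'l].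
      by rewrite ev_fatZ ev_d2 eqxx mul1r.
    by rewrite ev_fatZ ev_d2 eq_sym (negbTE ne_j'l) mul0r.
  rewrite -(ev_d2 p j) -dd2 dd1 ev_sum.
  by apply: eq_bigr => i _; rewrite evM.
rewrite -[LHS](fps_sumE _ _ (fun i => ev p (a i i))); congr (_ k); symmetry.
transitivity (\sum_i \sum_j \sum_l
    ev p (a l j) * (ev p (fapp (e' l) (y i)) * ev p (c i j))).
  apply: eq_bigr => i _.
  have h := feq_vfield_trans
    (P_linear_eq hphi VO (PeO i) (P_sum _ oO (sc i) Pe'O) (e_e' i))
    (P_linear_sum _ hphi VO (sc i) Pe'O).
  rewrite (feq_vfield_fapp h (opensub_refl oO) (sy i) Op) ev_fapp_sum.
  apply: eq_bigr => j _; rewrite ev_fappZ.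
  rewrite (feq_vfield_fapp (phi_e' j) WO (sy i) Op) ev_fapp_sum mulr_sumr.
  by apply: eq_bigr => l _; rewrite ev_fappZ mulrC -mulrA.
rewrite exchange_big; apply: eq_bigr => j _.
rewrite exchange_big (bigD1 j) //= [X in _ + X]big1 => [|l ne_lj].
  by rewrite -mulr_sumr inv eqxx mulr1 addr0.
by rewrite -mulr_sumr inv (negbTE ne_lj) mulr0.
Qed.

End LocalFrame.
End Trace.

(** * The exterior derivative of 1-forms *)

Section Forms.
Variables (R : realType) (m : nat) (M : smoothManifold R m).
Local Notation C := R[i].
Implicit Types (U V W : set M) (f g : functionT R M) (X Y Z : vfieldT R M).
Implicit Types (alpha beta : form1T R M) (omega eta : form2T R M).

(** Allows a 1-form known only on vector fields to be evaluated at any operator equal to one of them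
    as a section. *)
Lemma vfield_transfer U X Y : is_vfield U X -> eq_vfield U X Y -> is_vfield U Y.
Proof.
move=> hX XY V UV; have [oV VU] := UV; have {}hX := vfield_sub UV hX.
have {}XY f p : smooth V f -> V p -> X f p = Y f p.
  by move=> sf Vp; exact: (XY V f UV sf p Vp).
have [_ _ lX mX] := hX V (opensub_refl oV).
split=> [f sf|f g sf fg p Vp|a f g sf sg p Vp|f g sf sg p Vp].
- by apply: (smooth_eq oV _ (vfield_smooth oV hX sf)) => p Vp; exact: XY.
- rewrite -(XY f p sf Vp) -(XY g p (smooth_eq oV fg sf) Vp).
  exact: (vfield_eq oV hX sf fg Vp).
- rewrite -(XY _ p (smoothD oV (smoothM oV (smooth_cst V a) sf) sg) Vp).
  rewrite (lX a f g sf sg p Vp) !fctE /=.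
  by rewrite (XY f p sf Vp) (XY g p sg Vp).
- rewrite -(XY _ p (smoothM oV sf sg) Vp) (mX f g sf sg p Vp) !fctE /=.
  by rewrite (XY f p sf Vp) (XY g p sg Vp).
Qed.

Lemma eq_vfield_sub U V X Y : opensub U V -> eq_vfield U X Y -> eq_vfield V X Y.
Proof. by move=> UV XY W f /(opensub_trans UV); exact: XY. Qed.

(** Values of a trace are chosen point by point, so its smoothness and linearity have to be read off
    formulas valid near each point. *)
Lemma is_form1_local U alpha :
  (forall p, U p -> exists2 V, opennbhs_in U p V &
     exists2 beta, is_form1 V beta & eq_form1 V alpha beta) ->
  is_form1 U alpha.
Proof.
move=> loc W UW; have [oW WU] := UW.
have {}loc p : W p -> exists V beta, [/\ opensub W V, V p,
    is_form1 V beta & forall X q, is_vfield V X -> V q -> alpha X q = beta X q].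
  move=> Wp; have [V [[oV VU] Vp] [beta hb ab]] := loc p (WU p Wp).
  exists (W `&` V), beta; split=> //; first exact: opensubIl.
    exact: (form1_sub (opensubIr oW oV) hb).
  by move=> X q hX; exact: (ab _ X (opensubIr oW oV) hX q).
split=> [X hX|X Y hX XY p Wp|f X Y sf hX hY p Wp].
- apply: smooth_local => p Wp; have [V [beta [WV Vp hb ab]]] := loc p Wp.
  exists V => //; have hXV := vfield_sub WV hX.
  apply: (smooth_eq WV.1 _ (form1_smooth WV.1 hb hXV)) => q Vq.
  by rewrite (ab X q hXV Vq).
- have [V [beta [WV Vp hb ab]]] := loc p Wp.
  have hXV := vfield_sub WV hX; have XYV := eq_vfield_sub WV XY.
  rewrite (ab X p hXV Vp) (ab Y p (vfield_transfer hXV XYV) Vp).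
  exact: (form1_eq WV.1 hb hXV XYV Vp).
- have [V [beta [WV Vp hb ab]]] := loc p Wp.
  have hXV := vfield_sub WV hX; have hYV := vfield_sub WV hY.
  have sfV := smooth_sub WV.2 sf.
  rewrite (ab _ p (is_vfieldD (is_vfield_scale sfV hXV) hYV) Vp).
  rewrite !fctE (ab X p hXV Vp) (ab Y p hYV Vp).
  exact: (form1_linear WV.1 hb sfV hXV hYV Vp).
Qed.

(** Makes the tensoriality of [trace_curvature] in its two field arguments a consequence of its
    local expression as an exterior derivative. *)
Lemma is_form2_local U omega :
  (forall p, U p -> exists2 V, opennbhs_in U p V &
     exists2 eta, is_form2 V eta & eq_form2 V omega eta) ->
  is_form2 U omega.
Proof.
move=> loc W X UW hX; have [oW WU] := UW.
have {}loc p : W p -> exists V eta, [/\ opensub W V, V p,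
    is_form2 V eta & eq_form2 V omega eta].
  move=> Wp; have [V [[oV VU] Vp] [eta he oe]] := loc p (WU p Wp).
  exists (W `&` V), eta; split=> //; first exact: opensubIl.
    by move=> V' Y /(opensub_trans (opensubIr oW oV)); exact: he.
  by move=> V' Y Z /(opensub_trans (opensubIr oW oV)); exact: oe.
split.
- apply: is_form1_local => p Wp; have [V [eta [WV Vp he oe]]] := loc p Wp.
  exists V => //; have hXV := vfield_sub WV hX.
  exists (eta X); first by have [] := he V X (opensub_refl WV.1) hXV.
  by move=> V' Y VV' hY; exact: (oe V' X Y VV' (vfield_sub VV' hXV) hY).
- apply: is_form1_local => p Wp; have [V [eta [WV Vp he oe]]] := loc p Wp.
  exists V => //; have hXV := vfield_sub WV hX.
  exists (fun Y => eta Y X); first by have [] := he V X (opensub_refl WV.1) hXV.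
  by move=> V' Y VV' hY; exact: (oe V' Y X VV' hY (vfield_sub VV' hXV)).
- move=> p Wp; have [V [eta [WV Vp he oe]]] := loc p Wp.
  have hXV := vfield_sub WV hX; have VV := opensub_refl WV.1.
  rewrite (oe V X X VV hXV hXV p Vp).
  by have [_ _ ->] := he V X VV hXV.
Qed.

Lemma d1E alpha X Y p :
  d1 alpha X Y p = X (alpha Y) p - Y (alpha X) p - alpha (bracket X Y) p.
Proof. by []. Qed.

Lemma form1N U alpha X p : open U -> is_form1 U alpha -> is_vfield U X -> U p ->
  alpha (- X) p = - alpha X p.
Proof.
move=> oU ha hX Up; have hX0 := @is_vfield0 _ _ M U.
have := form1_linear oU ha (smooth_cst U (-1)) hX hX0 Up.
have -> : scale (cst (-1)) X + 0 = - X.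
  apply/funext => f; apply/funext => q.
  by rewrite -[LHS]/(-1 * X f q + 0) mulN1r addr0.
by rewrite (form1_0 oU ha Up) addr0 mulN1r.
Qed.

Lemma is_form2_d1 U alpha : is_form1 U alpha -> is_form2 U (d1 alpha).
Proof.
move=> ha V X UV hX; have [oV VU] := UV; have {}ha := form1_sub UV ha.
have form_d1X : is_form1 V (d1 alpha X).
  move=> W VW; have [oW WV] := VW; have {}hX := vfield_sub VW hX.
  have {}ha := form1_sub VW ha; have saX := form1_smooth oW ha hX.
  split=> [Y hY|Y Y' hY YY' p Wp|f Y Z sf hY hZ p Wp].
  - have saY := form1_smooth oW ha hY.
    apply: (smoothB oW _ (form1_smooth oW ha (is_vfield_bracket hX hY))).
    exact: (smoothB oW (vfield_smooth oW hX saY) (vfield_smooth oW hY saX)).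
  - have saY := form1_smooth oW ha hY.
    have aYY' : eq_fun W (alpha Y) (alpha Y').
      by move=> q Wq; exact: (form1_eq oW ha hY YY' Wq).
    have bYY' : eq_vfield W (bracket X Y) (bracket X Y').
      move=> O f WO sf q Oq;
        have [hXO hYO] := (vfield_sub WO hX, vfield_sub WO hY).
      have YfO : eq_fun O (Y f) (Y' f).
        by move=> r Or; exact: (YY' O f WO sf r Or).
      have sXf := vfield_smooth WO.1 hXO sf.
      rewrite -[LHS]/(X (Y f) q - Y (X f) q) -[RHS]/(X (Y' f) q - Y' (X f) q).
      rewrite (vfield_eq WO.1 hXO (vfield_smooth WO.1 hYO sf) YfO Oq).
      by rewrite (YY' O (X f) WO sXf q Oq).
    rewrite !d1E (vfield_eq oW hX saY aYY' Wp).
    rewrite (YY' W (alpha X) (opensub_refl oW) saX p Wp).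
    by rewrite (form1_eq oW ha (is_vfield_bracket hX hY) bYY' Wp).
  - have saY := form1_smooth oW ha hY; have saZ := form1_smooth oW ha hZ.
    have hbY := is_vfield_bracket hX hY; have hbZ := is_vfield_bracket hX hZ.
    have hfYZ := is_vfieldD (is_vfield_scale sf hY) hZ.
    have afYZ : eq_fun W (alpha (scale f Y + Z)) (f * alpha Y + alpha Z).
      by move=> q Wq; exact: (form1_linear oW ha sf hY hZ Wq).
    (* The term X(f) Y of the bracket cancels the derivative of [f] that the Leibniz rule produces
       in X(f alpha(Y)). *)
    have bfYZ : eq_vfield W (bracket X (scale f Y + Z))
        (scale (X f) Y + (scale f (bracket X Y) + bracket X Z)).
      move=> O g WO sg q Oq; have oO := WO.1; have sfO := smooth_sub WO.2 sf.
      have [hXO hYO hZO] :=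
        And3 (vfield_sub WO hX) (vfield_sub WO hY) (vfield_sub WO hZ).
      have sYg := vfield_smooth oO hYO sg; have sZg := vfield_smooth oO hZO sg.
      rewrite -[LHS]/(X (f * Y g + Z g) q - (f q * Y (X g) q + Z (X g) q)).
      rewrite (vfieldD oO hXO (smoothM oO sfO sYg) sZg Oq).
      rewrite (vfieldM oO hXO sfO sYg Oq).
      by rewrite /bracket /scale !fctE /=; ring.
    rewrite !d1E (vfield_eq oW hX (form1_smooth oW ha hfYZ) afYZ Wp).
    rewrite (vfieldD oW hX (smoothM oW sf saY) saZ Wp) (vfieldM oW hX sf saY
      Wp).
    rewrite (form1_eq oW ha (is_vfield_bracket hX hfYZ) bfYZ Wp).
    have sXf := vfield_smooth oW hX sf.
    rewrite (form1_linear oW ha sXf hY (is_vfieldD (is_vfield_scale sf hbY)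
      hbZ) Wp).
    rewrite (form1_linear oW ha sf hbY hbZ Wp).
    rewrite -[(scale f Y + Z) _ p]/(f p * Y (alpha X) p + Z (alpha X) p).
    by rewrite !fctE !d1E; ring.
split=> //.
(* The other slot follows by antisymmetry. The local criterion, with [V] itself as the
   neighbourhood, serves to replace a form by one that agrees with it on vector fields. *)
- apply: is_form1_local => p Vp; exists V; first by split=> //;
  exact: opensub_refl.
  exists (- d1 alpha X); first exact: is_form1N.
  move=> W Y VW hY q Wq; have hXW := vfield_sub VW hX.
  rewrite -[RHS]/(- d1 alpha X Y q) !d1E.
  have -> : bracket Y X = - bracket X Y by rewrite /bracket;
    apply/funext => f; rewrite [RHS]opprB.
  rewrite (form1N VW.1 (form1_sub VW ha) (is_vfield_bracket hXW hY) Wq).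
  by rewrite !opprD !opprK [X in _ = X + _]addrC.
- move=> p Vp; rewrite d1E subrr sub0r.
  have -> : bracket X X = 0 by rewrite /bracket; apply/funext => f;
    rewrite subrr.
  by rewrite (form1_0 oV ha Vp) oppr0.
Qed.

Lemma eq_form2_d1 U alpha beta : is_form1 U alpha -> eq_form1 U alpha beta ->
  eq_form2 U (d1 alpha) (d1 beta).
Proof.
move=> ha ab V X Y UV hX hY p Vp; have [oV VU] := UV.
have {}ha := form1_sub UV ha; rewrite !d1E.
rewrite (vfield_eq oV hX (form1_smooth oV ha hY) (ab V Y UV hY) Vp).
rewrite (vfield_eq oV hY (form1_smooth oV ha hX) (ab V X UV hX) Vp).
by rewrite (ab V _ UV (is_vfield_bracket hX hY) p Vp).
Qed.

Lemma eq_form2_d1B U alpha beta : is_form1 U alpha -> is_form1 U beta ->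
  eq_form2 U (d1 (alpha - beta)) (d1 alpha - d1 beta).
Proof.
move=> ha hb V X Y UV hX hY p Vp; have [oV VU] := UV.
have {}ha := form1_sub UV ha; have {}hb := form1_sub UV hb.
rewrite -[RHS]/(d1 alpha X Y p - d1 beta X Y p) !d1E.
rewrite (vfieldB oV hX (form1_smooth oV ha hY) (form1_smooth oV hb hY) Vp).
rewrite (vfieldB oV hY (form1_smooth oV ha hX) (form1_smooth oV hb hX) Vp).
rewrite -[(alpha - beta) _ p]/(alpha (bracket X Y) p - beta (bracket X Y) p).
by ring.
Qed.

End Forms.

(** * Formal 1-forms from formally linear maps *)

Section FormalLinear.
Variables (R : realType) (m : nat) (M : smoothManifold R m).
Local Notation C := R[i].
Implicit Types (U V W : set M) (f g : formal (functionT R M)).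
Implicit Types (X Y Z : formal (vfieldT R M)).
Implicit Types Phi : formal (vfieldT R M) -> formal (functionT R M).

(** A formal 1-form seen as a map on formal fields. Vanishing on [P] can be tested in this view,
    where a section of [P] enters as a whole and not by its coefficients. *)
Record formal_linear U Phi : Prop := FormalLinear {
  fl_smooth : forall V X, opensub U V -> fvfield V X -> fsmooth V (Phi X);
  fl_eq : forall V X Y p, opensub U V -> fvfield V X -> feq_vfield V X Y ->
    V p -> ev p (Phi X) = ev p (Phi Y);
  fl_lin : forall V f X Y p, opensub U V -> fsmooth V f -> fvfield V X ->
    fvfield V Y -> V p ->
    ev p (Phi (fscale f X + Y)) = ev p f * ev p (Phi X) + ev p (Phi Y) }.

Lemma formal_linearB U Phi Psi : formal_linear U Phi -> formal_linear U Psi ->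
  formal_linear U (fun X => Phi X - Psi X).
Proof.
move=> hF hG; split=> [V X UV hX|V X Y p UV hX XY Vp|V f X Y p UV sf hX hY Vp].
- exact: (fsmoothD UV.1 (fl_smooth hF UV hX)
           (fsmoothN UV.1 (fl_smooth hG UV hX))).
- by rewrite !evB (fl_eq hF UV hX XY Vp) (fl_eq hG UV hX XY Vp).
- rewrite !evB (fl_lin hF UV sf hX hY Vp) (fl_lin hG UV sf hX hY Vp).
  by rewrite mulrBr opprD addrACA.
Qed.

(** Inverse of the passage from a formal 1-form to its action [fapp]: a map linear over formal
    series is determined by its values on fields constant in t. *)
Definition form_of Phi : formal (form1T R M) := fun k v => Phi (tconst v) k.

Lemma ev_tconst_mul p (f : functionT R M) (a : fps C) k :
  (ev p (tconst f) * a) k = f p * a k.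
Proof.
rewrite -[LHS]/(conv (fun i j => tconst f i p * a j) k) /conv.
by rewrite big_ord_recl subn0 big1 ?addr0 // => i _; exact: mul0r.
Qed.

Lemma ev_tmul1 (p : M) (a : fps C) k :
  (ev p (tmul (tconst 1)) * a) k = if k is k'.+1 then a k' else 0.
Proof.
rewrite -[LHS]/(conv (fun i j => tmul (tconst (1 :
  functionT R M)) i p * a j) k).
case: k => [|k]; rewrite /conv big_ord_recl mul0r add0r;
  first by rewrite big_ord0.
rewrite big_ord_recl big1 ?addr0 => [|i _]; last exact: mul0r.
by rewrite /= subSS subn0 mul1r.
Qed.

Lemma form_of_form1 U Phi : formal_linear U Phi -> fform1 U (form_of Phi).
Proof.
move=> hF k V UV; have [oV VU] := UV.
split=> [X hX|X Y hX XY p Vp|f X Y sf hX hY p Vp].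
- exact: (fl_smooth hF UV (fvfield_tconst hX) k).
- have tXY : feq_vfield V (tconst X) (tconst Y).
    by case=> [|l]; [exact: XY | move=> W f].
  exact: (congr1 (fun h :
    fps C => h k) (fl_eq hF UV (fvfield_tconst hX) tXY Vp)).
- have tfXY : feq_vfield V (tconst (scale f X + Y))
      (fscale (tconst f) (tconst X) + tconst Y).
    apply: feq_vfieldI => W g q VW sg Wq.
    rewrite ev_fatD ev_fatZ !ev_fat_tconst -ev_tconstM.
    by apply/funext => -[|l] //; exact/esym/addr0.
  have hX' := fvfield_tconst hX; have hY' := fvfield_tconst hY.
  have hfXY := fvfield_tconst (is_vfieldD (is_vfield_scale sf hX) hY).
  have := fl_eq hF UV hfXY tfXY Vp.
  rewrite (fl_lin hF UV (fsmooth_tconst sf) hX' hY' Vp).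
  move=> /(congr1 (fun h : fps C => h k)) hk.
  rewrite -[LHS]/(ev p (Phi (tconst (scale f X + Y))) k) hk.
  rewrite -[LHS]/((ev p (tconst f) * ev p (Phi (tconst X))) k +
                  ev p (Phi (tconst Y)) k).
  by rewrite ev_tconst_mul.
Qed.

(* Writing [X = X_0 + t X'], linearity over the formal series reduces the k-th
   coefficient of [Phi X] to lower coefficients of [Phi X']. *)
Lemma fapp_form_of U V Phi X p : formal_linear U Phi -> opensub U V ->
  fvfield V X -> V p -> ev p (fapp (form_of Phi) X) = ev p (Phi X).
Proof.
move=> hF UV hX Vp; apply/funext => k.
elim: k X hX => [|k IHk] X hX.
all: pose X' : formal (vfieldT R M) := fun l => X l.+1.
all: have hX' : fvfield V X' by move=> l; exact: hX.
all: have hX0 := fvfield_tconst (hX 0%N).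
all: have st : fsmooth V (tmul (tconst (1 : functionT R M))).
1,3: by case=> [|l];
  [exact: smooth0 | exact: (fsmooth_tconst (smooth_cst V 1) l)].
all: have XE : feq_vfield V X
    (fscale (tmul (tconst (1 : functionT R M))) X' + tconst (X 0%N)).
1,3: apply: feq_vfieldI => W g q VW sg Wq; apply/funext => l.
1,2: rewrite ev_fatD ev_fatZ ev_fat_tconst -[RHS]/(
  (ev q (tmul (tconst 1)) * ev q (fat X' g)) l + ev q (tconst (X 0%N g)) l).
1,2: by rewrite ev_tmul1; case: l => [|l];
  [exact/esym/add0r | exact/esym/addr0].
all: rewrite (fl_eq hF UV hX XE Vp) (fl_lin hF UV st hX' hX0 Vp) ev_fappE.
  rewrite -[RHS]/((ev p (tmul (tconst 1)) * ev p (Phi X')) 0%N +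
    ev p (Phi (tconst (X 0%N))) 0%N) ev_tmul1 add0r.
  by rewrite /conv big_ord_recl big_ord0 addr0.
rewrite -[RHS]/((ev p (tmul (tconst 1)) * ev p (Phi X')) k.+1 +
    ev p (Phi (tconst (X 0%N))) k.+1) ev_tmul1.
rewrite -(IHk X' hX') ev_fappE convC /conv big_ord_recl subn0 addrC.
congr (_ + _); rewrite -/(conv (fun i j => form_of Phi j (X' i) p) k).
by rewrite convC.
Qed.

End FormalLinear.

(** * Formal connections and the trace of the connection matrix *)

Section Connections.
Variables (R : realType) (m : nat) (M : smoothManifold R m).
Local Notation C := R[i].
Local Notation vfields := (formal (vfieldT R M)).
Implicit Types (U V W : set M) (f g : formal (functionT R M)).
Implicit Types (X Y Z v w : formal (vfieldT R M)).
Variable nabla : vfields -> vfields -> vfields.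
Hypothesis hc : is_connection nabla.

Lemma conn_leibnizD V v f X Y : open V -> fsmooth V f -> fvfield V v ->
  fvfield V X -> fvfield V Y ->
  feq_vfield V (nabla v (fscale f X + Y))
    (fscale (fapp v f) X + (fscale f (nabla v X) + nabla v Y)).
Proof.
move=> oV sf hv hX hY; apply: feq_vfieldI => W g p VW sg Wp.
rewrite (feq_vfield_fat (conn_add hc oV hv (fvfieldZ sf hX) hY) VW sg Wp).
rewrite ev_fatD (feq_vfield_fat (conn_leibniz hc oV sf hv hX) VW sg Wp).
by rewrite !ev_fatD addrA.
Qed.

Lemma conn_eqr V v X Y : open V -> fvfield V v -> fvfield V X ->
  feq_vfield V X Y -> feq_vfield V (nabla v X) (nabla v Y).
Proof.
by move=> oV hv hX XY;
  exact: (conn_eq hc oV hv hX (@feq_vfield_refl _ _ M V v) XY).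
Qed.

Lemma conn_eql V v w X : open V -> fvfield V v -> fvfield V X ->
  feq_vfield V v w -> feq_vfield V (nabla v X) (nabla w X).
Proof.
by move=> oV hv hX vw;
  exact: (conn_eq hc oV hv hX vw (@feq_vfield_refl _ _ M V X)).
Qed.

Lemma conn0 V v g p : open V -> fvfield V v -> fsmooth V g -> V p ->
  ev p (fapp (nabla v 0) g) = 0.
Proof.
move=> oV hv sg Vp; have h0 := @fvfield0 _ _ M V.
have := feq_vfield_fapp (conn_add hc oV hv h0 h0) (opensub_refl oV) sg Vp.
by rewrite addr0 ev_fappD -[LHS]addr0 => /addrI.
Qed.

Lemma conn_sum V v (I : Type) (r : seq I) (c : I -> formal (functionT R M))
    (e : I -> vfields) g p : open V -> fvfield V v ->
  (forall i, fsmooth V (c i)) -> (forall i, fvfield V (e i)) ->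
  fsmooth V g -> V p ->
  ev p (fapp (nabla v (\sum_(i <- r) fscale (c i) (e i))) g) =
  \sum_(i <- r) (ev p (fapp v (c i)) * ev p (fapp (e i) g) +
                 ev p (c i) * ev p (fapp (nabla v (e i)) g)).
Proof.
move=> oV hv sc he sg Vp; elim: r => [|i r IHr].
  by rewrite !big_nil (conn0 oV hv sg Vp).
have hS : fvfield V (\sum_(j <- r) fscale (c j) (e j)).
  by apply: fvfield_sum => j; exact: (fvfieldZ (sc j) (he j)).
rewrite !big_cons -IHr.
rewrite (feq_vfield_fapp (conn_leibnizD oV (sc i) hv (he i) hS)
  (opensub_refl oV) sg Vp).
by rewrite !ev_fappD !ev_fappZ addrA.
Qed.

(* The trace of the connection matrix of [nabla] in the frame [e] with
   coordinate functionals [X |-> X (y i)]. *)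
Definition frame_trace n (e : 'I_n -> vfields)
    (y : 'I_n -> formal (functionT R M)) X : formal (functionT R M) :=
  \sum_i fapp (nabla X (e i)) (y i).

Lemma frame_trace_linear U n (e : 'I_n -> vfields)
    (y : 'I_n -> formal (functionT R M)) :
  (forall i, fvfield U (e i)) -> (forall i, fsmooth U (y i)) ->
  formal_linear U (frame_trace e y).
Proof.
move=> he sy; split=> [V X UV hX|V X Y p UV hX XY Vp|V f X Y p UV sf hX hY Vp].
all: have [oV VU] := UV; have heV i := fvfield_sub UV (he i).
all: have syV i := fsmooth_sub VU (sy i).
- apply: (fsmooth_sum _ _ oV) => i.
  exact: (fsmooth_fapp oV (conn_vfield hc oV hX (heV i)) (syV i)).
- rewrite !ev_sum; apply: eq_bigr => i _.
  exact: (feq_vfield_fapp (conn_eql oV hX (heV i) XY) (opensub_refl oV) (syV i)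
    Vp).
- rewrite !ev_sum mulr_sumr -big_split; apply: eq_bigr => i _.
  rewrite (feq_vfield_fapp (conn_linear hc oV sf hX hY (heV i)) (opensub_refl
    oV)
    (syV i) Vp).
  by rewrite ev_fappD ev_fappZ.
Qed.

End Connections.

(** * The trace of the curvature *)

Section Curvature.
Variables (R : realType) (m : nat) (M : smoothManifold R m).
Local Notation C := R[i].
Local Notation vfields := (formal (vfieldT R M)).
Variables (omega : formal (form2T R M)) (P : set M -> set vfields).
Hypothesis Psub : is_subsheaf P.
Hypothesis Pmod : is_submodule P.
Implicit Types (U V W : set M) (f g : formal (functionT R M)).
Implicit Types (X Y Z v w : formal (vfieldT R M)).
Implicit Types (nabla : vfields -> vfields -> vfields).

Lemma feq_vfieldB U X X' Y Y' : feq_vfield U X X' -> feq_vfield U Y Y' ->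
  feq_vfield U (X - Y) (X' - Y').
Proof.
move=> XX' YY'; apply: feq_vfieldI => V f p UV sf Vp.
rewrite !ev_fatD !ev_fatN.
by rewrite (feq_vfield_fat XX' UV sf Vp) (feq_vfield_fat YY' UV sf Vp).
Qed.

Lemma P_sub V X Y : open V -> P V X -> P V Y -> P V (X - Y).
Proof.
move=> oV PX PY.
have s1 : fsmooth V (- tconst (1 : functionT R M)).
  exact: (fsmoothN oV (fsmooth_tconst (smooth_cst V 1))).
apply: (subsheaf_eq Psub oV ((Pmod oV).2 _ _ _ s1 PY PX)).
apply: feq_vfieldI => W f p VW sf Wp.
by rewrite !ev_fatD ev_fatN ev_fatZ evN ev_tconst1 mulN1r addrC.
Qed.

(** The derivatives of [f] cancel: the mixed first-order terms are symmetric in [v] and [w], and the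
    second-order ones add up to the bracket applied to [f]. *)
Lemma curvature_P_linear V nabla v w : symplectic_connection omega P nabla ->
  fvfield V v -> fvfield V w -> P_linear P V (curvature nabla v w).
Proof.
move=> hn hv hw; have hc := sc_connection hn.
split=> [W X VW PX|W X Y VW PX PY XY|W f X Y VW sf PX PY].
all: have oW := VW.1; have {}hv := fvfield_sub VW hv;
  have {}hw := fvfield_sub VW hw.
all: have hb := fvfield_bracket hv hw.
all: have hX := subsheaf_vfield Psub oW PX.
- have Pn u : fvfield W u -> forall Z, P W Z -> P W (nabla u Z).
    by move=> hu Z PZ; exact: (sc_preserves_polarization hn oW hu PZ).
  exact: (P_sub oW (P_sub oW (Pn v hv _ (Pn w hw X PX)) (Pn w hw _ (Pn v hv X
    PX)))
            (Pn _ hb X PX)).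
- have c2 u u' : fvfield W u -> fvfield W u' ->
      feq_vfield W (nabla u (nabla u' X)) (nabla u (nabla u' Y)).
    move=> hu hu'; apply: (conn_eqr hc oW hu (conn_vfield hc oW hu' hX)).
    exact: (conn_eqr hc oW hu' hX XY).
  apply: feq_vfieldB (conn_eqr hc oW hb hX XY).
  exact: (feq_vfieldB (c2 v w hv hw) (c2 w v hw hv)).
have hY := subsheaf_vfield Psub oW PY.
have hfXY := fvfieldD (fvfieldZ sf hX) hY.
have n2 u u' O (g : functionT R M) p : fvfield W u -> fvfield W u' ->
  opensub W O -> smooth O g ->
    O p -> ev p (fat (nabla u (nabla u' (fscale f X + Y))) g) =
    ev p (fapp u (fapp u' f)) * ev p (fat X g) +
    (ev p (fapp u' f) * ev p (fat (nabla u X) g) +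
     (ev p (fapp u f) * ev p (fat (nabla u' X) g) +
      (ev p f * ev p (fat (nabla u (nabla u' X)) g) +
       ev p (fat (nabla u (nabla u' Y)) g)))).
  move=> hu hu' WO sg Op.
  have hu'X := conn_vfield hc oW hu' hX; have hu'Y := conn_vfield hc oW hu' hY.
  have su'f := fsmooth_fapp oW hu' sf.
  have hS := fvfieldD (fvfieldZ sf hu'X) hu'Y.
  have e1 := conn_eqr hc oW hu (conn_vfield hc oW hu' hfXY)
    (conn_leibnizD hc oW sf hu' hX hY).
  rewrite (feq_vfield_fat e1 WO sg Op).
  rewrite (feq_vfield_fat (conn_leibnizD hc oW su'f hu hX hS) WO sg Op).
  rewrite !ev_fatD !ev_fatZ.
  rewrite (feq_vfield_fat (conn_leibnizD hc oW sf hu hu'X hu'Y) WO sg Op).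
  by rewrite !ev_fatD !ev_fatZ.
(* The names spell the operators: [vwf] is v(w f), [vwx] is the value on the test function of
   nabla_v nabla_w X, and [bx], [by_] come from the derivative along the bracket. *)
have ringE (A :
  comNzRingType) (vwf wvf wf vf f0 x vx wx vwx wvx vwy wvy bx by_ : A) :
    vwf * x + (wf * vx + (vf * wx + (f0 * vwx + vwy))) -
    (wvf * x + (vf * wx + (wf * vx + (f0 * wvx + wvy)))) -
    ((vwf - wvf) * x + (f0 * bx + by_)) =
    f0 * (vwx - wvx - bx) + (vwy - wvy - by_) by ring.
apply: feq_vfieldI => O g p WO sg Op;
  rewrite !ev_fatD ev_fatZ !ev_fatD !ev_fatN.
rewrite (n2 v w O g p hv hw WO sg Op) (n2 w v O g p hw hv WO sg Op).
rewrite (feq_vfield_fat (conn_leibnizD hc oW sf hb hX hY) WO sg Op).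
rewrite !ev_fatD !ev_fatZ (fapp_bracket oW hv hw sf (WO.2 p Op)).
exact: ringE.
Qed.

(** Both connections obey the same Leibniz rule, so the terms v(f) X cancel in the difference. *)
Lemma connection_diff_P_linear V nabla1 nabla2 v :
  symplectic_connection omega P nabla1 ->
    symplectic_connection omega P nabla2 ->
  fvfield V v -> P_linear P V (fun X => nabla1 v X - nabla2 v X).
Proof.
move=> h1 h2 hv; have c1 := sc_connection h1; have c2 := sc_connection h2.
split=> [W X VW PX|W X Y VW PX PY XY|W f X Y VW sf PX PY].
all: have oW := VW.1; have {}hv := fvfield_sub VW hv.
all: have hX := subsheaf_vfield Psub oW PX.
- exact: (P_sub oW (sc_preserves_polarization h1 oW hv PX)
           (sc_preserves_polarization h2 oW hv PX)).
- exact: (feq_vfieldB (conn_eqr c1 oW hv hX XY) (conn_eqr c2 oW hv hX XY)).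
have hY := subsheaf_vfield Psub oW PY.
apply: feq_vfieldI => O g p WO sg Op;
  rewrite !ev_fatD ev_fatZ !ev_fatD !ev_fatN.
rewrite (feq_vfield_fat (conn_leibnizD c1 oW sf hv hX hY) WO sg Op).
rewrite (feq_vfield_fat (conn_leibnizD c2 oW sf hv hX hY) WO sg Op).
rewrite !ev_fatD !ev_fatZ mulrBr opprD addrACA subrr add0r.
by rewrite opprD addrACA.
Qed.

Section Frame.
Variables (U : set M) (n : nat) (e : 'I_n -> vfields)
  (y : 'I_n -> formal (functionT R M)).
Hypothesis frame : local_frame P U e y.

Let he i : fvfield U (e i) := frame_vfield Psub frame i.

(* With [theta] the connection matrix, the trace of [d theta + theta wedge theta]
   is [d (tr theta)] as the trace of [theta wedge theta] vanishes. *)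
Lemma frame_trace_curvature nabla V v w p :
  symplectic_connection omega P nabla ->
  opensub U V -> fvfield V v -> fvfield V w -> V p ->
  \sum_i ev p (fapp (curvature nabla v w (e i)) (y i)) =
  ev p (fapp v (frame_trace nabla e y w)) - ev p (fapp w (frame_trace nabla e y
    v))
  - ev p (frame_trace nabla e y (fbracket v w)).
Proof.
move=> hn UV hv hw Vp; have hc := sc_connection hn; have [oV VU] := UV.
have heV i := fvfield_sub UV (he i).
have syV i := fsmooth_sub VU (frame_smooth frame i).
have st u i j : fvfield V u -> fsmooth V (fapp (nabla u (e j)) (y i)).
  by move=> hu; exact: (fsmooth_fapp oV (conn_vfield hc oV hu (heV j)) (syV i)).
have n2 u u' j : fvfield V u -> fvfield V u' ->
    ev p (fapp (nabla u (nabla u' (e j))) (y j)) =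
    ev p (fapp u (fapp (nabla u' (e j)) (y j))) +
    \sum_i ev p (fapp (nabla u' (e j)) (y i)) * ev p (fapp (nabla u (e i)) (y
      j)).
  move=> hu hu'; have hu'e := conn_vfield hc oV hu' (heV j).
  have Pu'e := sc_preserves_polarization hn oV hu' (frame_in_sub Psub frame j
    UV).
  have e1 := conn_eqr hc oV hu hu'e (frame_span frame UV Pu'e).
  rewrite (feq_vfield_fapp e1 (opensub_refl oV) (syV j) Vp).
  rewrite (conn_sum hc _ oV hu (fun i => st u' i j hu') heV (syV j) Vp).
  rewrite big_split /=; congr (_ + _).
  rewrite (bigD1 j) //= big1 ?addr0 => [|i ne_ij].
    by rewrite (frame_dual frame _ _ (VU p Vp)) eqxx mulr1.
  by rewrite (frame_dual frame _ _ (VU p Vp)) (negbTE ne_ij) mulr0.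
(* The quadratic terms are collected apart, because they cancel only after summation over both
   indices, by exchanging [i] and [j]. *)
transitivity (\sum_j (ev p (fapp v (fapp (nabla w (e j)) (y j)))
    - ev p (fapp w (fapp (nabla v (e j)) (y j)))
    - ev p (fapp (nabla (fbracket v w) (e j)) (y j))) +
  (\sum_j \sum_i ev p (fapp (nabla w (e j)) (y i)) * ev p (fapp (nabla v (e i))
    (y j))
  - \sum_j \sum_i ev p (fapp (nabla v (e j)) (y i)) * ev p (fapp (nabla w (e
    i)) (y j)))).
  rewrite -sumrB -big_split; apply: eq_bigr => j _.
  rewrite !ev_fappD !ev_fappN (n2 v w j hv hw) (n2 w v j hw hv).
  by rewrite opprD [in LHS]addrACA [LHS]addrAC.
rewrite [X in _ + (X - _)]exchange_big /=.
rewrite [X in _ + X](_ : _ = 0) ?addr0; last first.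
  apply/eqP; rewrite subr_eq0; apply/eqP.
  by apply: eq_bigr => j _; apply: eq_bigr => i _; rewrite mulrC.
rewrite !sumrB; congr (_ - _ - _); last by rewrite ev_sum.
  by rewrite (fappr_sum oV hv Vp _ (fun j => st w j j hw)).
by rewrite (fappr_sum oV hw Vp _ (fun j => st v j j hv)).
Qed.

Lemma trace_curvature_frame nabla : symplectic_connection omega P nabla ->
  feq_form2 U (trace_curvature P nabla) (fd1 (form_of (frame_trace nabla e y))).
Proof.
move=> hn k V v w UV hv hw p Vp; have [oV VU] := UV;
  have hc := sc_connection hn.
have [hv' hw'] := (fvfield_tconst hv, fvfield_tconst hw).
have hT := frame_trace_linear hc he (frame_smooth frame).
rewrite /trace_curvature.
rewrite (trace_frame Psub Pmod frame k oV (curvature_P_linear hn hv' hw') (VU p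
  Vp) Vp).
rewrite (frame_trace_curvature hn UV hv' hw' Vp).
(* The two brackets are equal as sections but not as operators: the positive coefficients of the
   first one involve [v 0] and [w 0], which vanish only where [v] and [w] are vector fields. *)
have -> : ev p (frame_trace nabla e y (fbracket (tconst v) (tconst w))) =
    ev p (frame_trace nabla e y (tconst (bracket v w))).
  apply: (fl_eq hT UV (fvfield_bracket hv' hw') _ Vp).
  apply: feq_vfieldI => W g q VW sg Wq; apply/funext => l.
  have [hvW hwW] := (vfield_sub VW hv, vfield_sub VW hw).
  rewrite -[LHS]/(fbracket (tconst v) (tconst w) l g q) /fbracket /cauchy.
  rewrite !fct_sumE big_ord_recl subn0 big1 ?addr0 => [|i _].
    case: l => [|l] //.
    rewrite -[LHS]/(v 0 q - 0) (vfield0 VW.1 hvW Wq); exact: subrr.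
  rewrite -[LHS]/(0 - tconst w (l - (lift ord0 i))%N 0 q).
  move: (l - _)%N => [|l']; last exact: subrr.
  by rewrite -[LHS]/(0 - w 0 q) (vfield0 VW.1 hwW Wq) subrr.
rewrite -[LHS]/(ev p (fapp (tconst v) (frame_trace nabla e y (tconst w))) k
  - ev p (fapp (tconst w) (frame_trace nabla e y (tconst v))) k
  - ev p (frame_trace nabla e y (tconst (bracket v w))) k).
by rewrite !fapp_tconst.
Qed.

Lemma form_of_perp Phi : formal_linear U Phi ->
  (forall V X p, opensub U V -> P V X -> V p -> ev p (Phi X) = 0) ->
  perp P U (form_of Phi).
Proof.
move=> hF Phi0; split; first exact: form_of_form1.
move=> V X UV PX; apply/feq_funP => p Vp.
rewrite (fapp_form_of hF UV (subsheaf_vfield Psub UV.1 PX) Vp).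
exact: Phi0 UV PX Vp.
Qed.

Lemma frame_trace_perp nabla : symplectic_connection omega P nabla ->
  flat_frame P nabla U e -> perp P U (form_of (frame_trace nabla e y)).
Proof.
move=> hn flat.
apply: form_of_perp.
  exact: (frame_trace_linear (sc_connection hn) he (frame_smooth frame)).
move=> V X p UV PX Vp; rewrite ev_sum big1 // => i _.
have syV := fsmooth_sub UV.2 (frame_smooth frame i).
rewrite (feq_vfield_fapp (flat V X i UV PX) (opensub_refl UV.1) syV Vp).
exact: ev_fapp0.
Qed.

End Frame.
End Curvature.

(** * Passage from Darboux frames to global statements on the manifold *)

Theorem lemma5p3 (R : realType) (m : nat) (M : smoothManifold R m)
  (omega : formal (form2T R M)) (P : set M -> set (formal (vfieldT R M)))
  (nabla : formal (vfieldT R M) -> formal (vfieldT R M) -> formal (vfieldT R M))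
  (hM : formal_polarized_symplectic omega P)
  (hnabla : symplectic_connection omega P nabla) :
  dperp P setT (trace_curvature P nabla) /\
  forall nabla1 : formal (vfieldT R M) -> formal (vfieldT R M) ->
                  formal (vfieldT R M),
    symplectic_connection omega P nabla1 ->
    exists alpha : formal (form1T R M),
      perp P setT alpha /\
      feq_form2 setT (trace_curvature P nabla1 - trace_curvature P nabla)
        (fd1 alpha).
Proof.
have [_ _ _ [Psub Pmod _ _] _] := hM.
have nbhsT U (p : M) : open U -> U p -> opennbhs_in setT p U by [].
split.
  split=> [k|p _].
    (* That the trace is a 2-form comes from its agreement with an exact form near each point. *)
    apply: is_form2_local => p _.
    have [U [n [e [y [Up frame _]]]]] := polarized_frame p hM.
    exists U; first exact: (nbhsT U p (frame_open frame) Up).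
    exists (d1 (form_of (frame_trace nabla e y) k)).
      apply: is_form2_d1; apply: form_of_form1.
      exact: (frame_trace_linear (sc_connection hnabla) (frame_vfield Psub
        frame)
        (frame_smooth frame)).
    exact: (trace_curvature_frame Psub Pmod frame hnabla k).
  have [U [n [e [y [Up frame flat]]]]] := polarized_frame p hM.
  exists U; first exact: (nbhsT U p (frame_open frame) Up).
  exists (form_of (frame_trace nabla e y)).
    exact: (frame_trace_perp Psub frame hnabla (flat nabla hnabla)).
  exact: (trace_curvature_frame Psub Pmod frame hnabla).
move=> nabla1 hnabla1.
(* Written as a trace, the form is defined on all of [M] from the start; gluing is then the
   comparison [alphaE] with the frame formulas. *)
pose alpha : formal (form1T R M) := fun k v =>
  trace_on P (fun X => nabla1 (tconst v) X - nabla (tconst v) X) k.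
exists alpha.
pose Phi n (e : 'I_n -> formal (vfieldT R M)) (y : 'I_n ->
  formal (functionT R M)) X :=
  frame_trace nabla1 e y X - frame_trace nabla e y X.
have linPhi U n (e : 'I_n -> formal (vfieldT R M)) y :
    local_frame P U e y -> formal_linear U (Phi n e y).
  move=> frame; apply: formal_linearB.
    exact: (frame_trace_linear (sc_connection hnabla1) (frame_vfield Psub frame)
      (frame_smooth frame)).
  exact: (frame_trace_linear (sc_connection hnabla) (frame_vfield Psub frame)
    (frame_smooth frame)).
have alphaE U n (e : 'I_n -> formal (vfieldT R M)) y : local_frame P U e y ->
    feq_form1 U alpha (form_of (Phi n e y)).
  move=> frame k V v UV hv p Vp; rewrite /alpha.
  rewrite (trace_frame Psub Pmod frame k UV.1 (connection_diff_P_linear Psub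
    Pmod
    hnabla1 hnabla (fvfield_tconst hv)) (UV.2 p Vp) Vp).
  rewrite -[RHS]/(ev p (Phi n e y (tconst v)) k) /Phi evB !ev_sum -sumrB.
  congr (_ k); apply: eq_bigr => i _.
  by rewrite ev_fappD ev_fappN.
have formalpha : fform1 setT alpha.
  move=> k; apply: is_form1_local => p _.
  have [U [n [e [y [Up frame _]]]]] := polarized_frame p hM.
  exists U; first exact: (nbhsT U p (frame_open frame) Up).
  exists (form_of (Phi n e y) k); last exact: (alphaE U n e y frame k).
  exact: (form_of_form1 (linPhi U n e y frame) k).
split.
  split=> // V X [oV _] PX; apply/feq_funP => p Vp.
  have [U [n [e [y [Up frame flat]]]]] := polarized_frame p hM.
  have UUV := opensubIl (frame_open frame) oV.
  have VUV := opensubIr (frame_open frame) oV.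
  have UVp : (U `&` V) p by [].
  have PX' := subsheaf_restrict Psub oV VUV PX.
  have hX := subsheaf_vfield Psub UUV.1 PX'.
  rewrite (feq_form1_fapp (alphaE U n e y frame) UUV hX UVp).
  rewrite (fapp_form_of (linPhi U n e y frame) UUV hX UVp) /Phi evB.
  have p1 := (frame_trace_perp Psub frame hnabla1 (flat nabla1 hnabla1)).2.
  have p0 := (frame_trace_perp Psub frame hnabla (flat nabla hnabla)).2.
  have l1 := frame_trace_linear (sc_connection hnabla1) (frame_vfield Psub
    frame)
    (frame_smooth frame).
  have l0 := frame_trace_linear (sc_connection hnabla) (frame_vfield Psub frame)
    (frame_smooth frame).
  (* The frame traces are converted back to forms, for which the vanishing on [P] is recorded in
     [perp]. *)
  rewrite -(fapp_form_of l1 UUV hX UVp) -(fapp_form_of l0 UUV hX UVp).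
  rewrite ((feq_funP _ _ _).1 (p1 _ X UUV PX') p UVp).
  by rewrite ((feq_funP _ _ _).1 (p0 _ X UUV PX') p UVp) subrr.
move=> k V v w [oV _] hv hw p Vp.
have [U [n [e [y [Up frame flat]]]]] := polarized_frame p hM.
have UUV := opensubIl (frame_open frame) oV.
have VUV := opensubIr (frame_open frame) oV.
have UVp : (U `&` V) p by [].
have [hv' hw'] := (vfield_sub VUV hv, vfield_sub VUV hw).
have l1 := frame_trace_linear (sc_connection hnabla1) (frame_vfield Psub frame)
  (frame_smooth frame).
have l0 := frame_trace_linear (sc_connection hnabla) (frame_vfield Psub frame)
  (frame_smooth frame).
have f1 := form_of_form1 l1 k; have f0 := form_of_form1 l0 k.
have fa : is_form1 U (alpha k).
  exact: (form1_sub (conj (frame_open frame) (@subsetT _ U)) (formalpha k)).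
rewrite -[RHS]/(d1 (alpha k) v w p).
rewrite (eq_form2_d1 fa (alphaE U n e y frame k) UUV hv' hw' UVp).
(* As [form_of] only evaluates, the form of a difference is the difference of the forms by
   conversion. *)
rewrite -[form_of _ k]/(form_of (frame_trace nabla1 e y) k -
  form_of (frame_trace nabla e y) k).
rewrite (eq_form2_d1B f1 f0 UUV hv' hw' UVp).
rewrite -[LHS]/(trace_curvature P nabla1 k v w p - trace_curvature P nabla k v
  w p).
have t1 := trace_curvature_frame Psub Pmod frame hnabla1.
have t0 := trace_curvature_frame Psub Pmod frame hnabla.
by rewrite (t1 k _ v w UUV hv' hw' p UVp) (t0 k _ v w UUV hv' hw' p UVp).
Qed.
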